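(* Let $\mathbb{F}$ be an algebraically closed field of characteristic $p\geq 0$. Let $G=\mathrm{SL}_n(\mathbb{F})$ with $n=r+1\geq 8$, and let $L(\lambda)$ be an irreducible $\mathbb{F}G$-representation with highest weight $\lambda$, which is restricted if $p>0$. Suppose that $\dim L(\lambda)\leq M$, where $M:=\binom{n}{4}$ if $n\neq 22$ and $M:=8176$ if $n=22$. Then $\lambda$ is one of the following: $0$; $a\varpi_1$ or $a\varpi_r$ with $1\leq a\leq 3$; $\varpi_1+\varpi_r$; $\varpi_2$ or $\varpi_{r-1}$; $\varpi_3$ or $\varpi_{r-2}$; $\varpi_4$ or $\varpi_{r-3}$; $\varpi_1+\varpi_2$ or $\varpi_{r-1}+\varpi_r$; $2\varpi_1+\varpi_r$ or $\varpi_1+2\varpi_r$; $\varpi_2+\varpi_r$ or $\varpi_1+\varpi_{r-1}$.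
   Context: $\varpi_1,\ldots,\varpi_r$ are the fundamental weights of $\mathrm{SL}_{r+1}$ with respect to a fixed maximal torus and simple roots, in the standard ordering ($\varpi_j$ is the highest weight of the $j$-th exterior power of the natural module). $L(\lambda)$ is the irreducible rational module with highest weight $\lambda$. A dominant weight $\lambda=\sum_i a_i\varpi_i$ is restricted (when $p>0$) if $0\le a_i<p$ for all $i$. *)

(* Defs.v *)
From HB Require Import structures.
From mathcomp Require Import all_boot all_order all_algebra.
From mathcomp Require Import mpoly.

Set Implicit Arguments.
Unset Strict Implicit.
Unset Printing Implicit Defensive.

Import GRing.Theory.
Local Open Scope ring_scope.

Definition has_characteristic (F : fieldType) (p : nat) : Prop :=
  if p == 0%N then [pchar F] =i pred0 else p \in [pchar F].

Definition SL (n : nat) (F : fieldType) : {pred 'M[F]_n} :=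
  [pred A : 'M[F]_n | \det A == 1].
Arguments SL : clear implicits.

(* As with mx_repr, rho is a total function that is only meaningful on the
   group; group elements act on V from the left. *)
Definition is_repr (n : nat) (F : fieldType) (V : vectType F)
    (rho : 'M[F]_n -> 'End(V)) : Prop :=
  rho 1%:M = \1%VF /\
  {in SL n F &, forall A B, rho (A *m B) = (rho A \o rho B)%VF}.

(* The coordinate ring of SL_n is a quotient of the polynomial ring in the n^2
   matrix entries, so a regular function on SL_n is one that agrees on SL_n
   with a polynomial in the entries. *)
Definition regular_on_SL (n : nat) (F : fieldType) (f : 'M[F]_n -> F) : Prop :=
  exists P : {mpoly F[n * n]},
    {in SL n F, forall A, f A = P.@[fun k => mxvec A 0 k]}.

Definition is_rational_repr (n : nat) (F : fieldType) (V : vectType F)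
    (rho : 'M[F]_n -> 'End(V)) : Prop :=
  is_repr rho /\
  forall (phi : 'Hom(V, F^o)) (v : V), regular_on_SL (fun A => phi (rho A v)).

Definition is_irreducible (n : nat) (F : fieldType) (V : vectType F)
    (rho : 'M[F]_n -> 'End(V)) : Prop :=
  {:V}%VS <> 0%VS /\
  forall U : {vspace V}, {in SL n F, forall A, (rho A @: U <= U)%VS} ->
    U = 0%VS \/ U = {:V}%VS.

(* Dominant weights of SL_(r+1), given by their coefficients on the fundamental
   weights; the fundamental weights are numbered from 1 in the literature, so
   the coefficient of the (i+1)-st one is stored at i : 'I_r. *)
Definition dominant_weight (r : nat) := {ffun 'I_r -> nat}.

Definition fundamental_weight (r j : nat) : {ffun 'I_r -> nat} :=
  [ffun i : 'I_r => nat_of_bool (i.+1 == j)].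

Definition restricted (p r : nat) (lambda : dominant_weight r) : Prop :=
  forall i, (lambda i < p)%N.

(* With respect to the diagonal torus and the upper triangular Borel subgroup,
   the j-th fundamental weight is diag(t_1, ..., t_n) |-> t_1 * ... * t_j, the
   weight of e_1 /\ ... /\ e_j in the j-th exterior power of F^n. *)
Definition weight_character (F : fieldType) (r : nat)
    (lambda : dominant_weight r) (t : 'rV[F]_r.+1) : F :=
  \prod_(j < r) (\prod_(i < r.+1 | (i <= j)%N) t 0 i) ^+ lambda j.

Definition upper_unitriangular (n : nat) (F : fieldType) (u : 'M[F]_n) : Prop :=
  forall i j : 'I_n, (j <= i)%N -> u i j = (i == j)%:R.

(* A maximal vector: a nonzero vector that is fixed by the unipotent radical of
   the Borel subgroup and on which the torus acts through lambda. In an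
   irreducible rational module it is unique up to scalars, and its weight is by
   definition the highest weight. *)
Definition is_maximal_vector (F : fieldType) (r : nat) (V : vectType F)
    (rho : 'M[F]_r.+1 -> 'End(V)) (lambda : dominant_weight r) (v : V) : Prop :=
  [/\ v != 0,
      forall u, upper_unitriangular u -> rho u v = v &
      forall t : 'rV[F]_r.+1, diag_mx t \in SL r.+1 F ->
        rho (diag_mx t) v = weight_character lambda t *: v].

Definition has_highest_weight (F : fieldType) (r : nat) (V : vectType F)
    (rho : 'M[F]_r.+1 -> 'End(V)) (lambda : dominant_weight r) : Prop :=
  exists v : V, is_maximal_vector rho lambda v.

Definition dim_bound (n : nat) : nat :=
  if n == 22%N then 8176%N else 'C(n, 4).

(* Main.v *)
Require Import Defs.
From Stdlib Require Import Classical.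
From HB Require Import structures.
From mathcomp Require Import all_boot all_order all_fingroup all_algebra.
From mathcomp Require Import mpoly.
From mathcomp Require Import zify ring.

(** The dimension of L(lambda) is at least the number of its weights, and that
    number exceeds the bound unless lambda is in the list. The weights come from
    a theorem of Suprunenko and Premet: when lambda is restricted, every
    dominant weight below lambda is a weight of L(lambda). The instances that
    matter here have an elementary proof, which reads them off one matrix
    coefficient.

    Let v be a maximal vector, and let phi be a functional that is fixed by the
    lower unitriangular group; a row of the top spectral projection of a generic
    one-parameter torus is one ([exists_lowest_functional]). On the big cell of
    matrices l t u, and so on all of SL by density, phi (g v) is a constant
    times the product of the powers Delta_j(g)^(lambda_j), where Delta_j is the
    leading minor of size j ([matrix_coefficient]), and irreducibility makes the
    constant nonzero. Hence nu is a weight as soon as the monomial t^nu occurs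
    in that product at x diag(t) g for some x and g in SL, and the dimension is
    at least the number of such nu ([irreducible_weights_leq_dim]).

    It remains to choose x and g. If x is the upper triangular matrix of ones
    and g is lower unitriangular, then Delta_j(x diag(t) g) is t_1 .. t_(j-1)
    times the linear form with terms t_i g_ij for i >= j ([lead_minor_star]).
    The entries g_ij with i > j are free. As lambda_j is smaller than the
    characteristic, polarization extracts every monomial of degree lambda_j from
    the power lambda_j of this form. In terms of the partition of lambda: moving
    at most lambda_j units away from each position j, to later positions,
    produces a weight ([moved_torus_weight]), and so do all rearrangements. One
    more weight is needed, (1,1,1,1) for twice the second fundamental weight,
    and it comes from another choice of x and g ([double_second_weight]).

    The rest is counting. A level set with k entries, 5 <= k <= n - 5, has at
    least C(n,k) images under rearrangement. A weight with exactly four entries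
    that differ from a value c, not all four equal, has at least 4 C(n,4)
    rearrangements. A weight with four entries in some set of values together
    with one that has three gives C(n,4) + C(n,3). Each of these numbers exceeds
    the bound, for n = 22 too. If lambda has at most three entries off the value
    taken on the middle positions, a few moves lead to one of these
    configurations unless lambda is in the list ([low_cases]); in the other
    cases lambda itself is enough, apart from the multiples of the fourth
    fundamental weight, where one move settles the proper ones
    ([fourth_coeff]). This treats the
    weights with at least as many entries above the middle value as below; the
    automorphism of SL that combines the inverse transpose with the reversal of
    the basis ([flip]) reduces the others to them. *)

Set Implicit Arguments.
Unset Strict Implicit.
Unset Printing Implicit Defensive.

Import GRing.Theory.
Local Open Scope ring_scope.

(** * Functions on SL_n along rational curves *)

Lemma poly_zero_closed (F : closedFieldType) (p : {poly F}) :
  (forall s, p.[s] = 0) -> p = 0.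
Proof.
move=> p0; apply/eqP; apply: contraT => pn0.
(* Otherwise p + 1 is not constant and has a root, at which p is -1. *)
have sz : size (p + 1) != 1%N.
  apply/negP => /eqP/eqP/size_poly1P[c _ pc].
  have pE : p = (c - 1)%:P by rewrite polyCB -pc addrK.
  by move: (p0 0) pn0; rewrite pE hornerC => ->; rewrite polyC0 eqxx.
have [x] := closed_rootP _ sz.
by rewrite rootE hornerD hornerC p0 add0r oner_eq0.
Qed.

Lemma poly_generic_eq (F : closedFieldType) (z p q : {poly F}) :
  z != 0 -> (forall s, z.[s] != 0 -> p.[s] = q.[s]) -> p = q.
Proof.
move=> zn0 h; apply/eqP; rewrite -subr_eq0.
suff /eqP : (p - q) * z = 0 by rewrite mulf_eq0 (negPf zn0) orbF.
apply: poly_zero_closed => s; rewrite hornerM hornerD hornerN.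
by have [->|/h->] := eqVneq z.[s] 0; rewrite ?mulr0 // subrr mul0r.
Qed.

Definition mxeval (F : fieldType) m n (s : F) (M : 'M[{poly F}]_(m, n)) :
  'M[F]_(m, n) := map_mx (horner_eval s) M.

Lemma mxevalE (F : fieldType) m n s (M : 'M[{poly F}]_(m, n)) i j :
  mxeval s M i j = (M i j).[s].
Proof. by rewrite mxE. Qed.

Lemma mxevalM (F : fieldType) m n q s (M : 'M[{poly F}]_(m, n))
    (N : 'M_(n, q)) :
  mxeval s (M *m N) = mxeval s M *m mxeval s N.
Proof. exact: map_mxM. Qed.

Lemma mxevalC (F : fieldType) m n s (M : 'M[F]_(m, n)) :
  mxeval s (map_mx polyC M) = M.
Proof. by apply/matrixP => i j; rewrite !mxE /horner_eval hornerC. Qed.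

Lemma det_mxeval (F : fieldType) n s (M : 'M[{poly F}]_n) :
  \det (mxeval s M) = (\det M).[s].
Proof. exact: det_map_mx. Qed.

(** The exponent N is only bounded from below, so that several functions can be
    given a common denominator. *)
Lemma mpoly_curve (F : fieldType) k (P : {mpoly F[k]}) (q : 'I_k -> {poly F})
    (D : {poly F}) :
  exists N0 : nat, forall N, (N0 <= N)%N -> exists R : {poly F},
    forall s, D.[s] != 0 ->
      R.[s] = D.[s] ^+ N * P.@[fun i => (q i).[s] / D.[s]].
Proof.
elim/mpolyind: P => [|c m P _ _ [N0 IH]].
  by exists 0%N => N _; exists 0 => s _; rewrite horner0 meval0 mulr0.
exists (maxn N0 (\sum_(i < k) m i)) => N; rewrite geq_max => /andP[leN lem].
have [R RE] := IH N leN.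
pose M := (\prod_(i < k) q i ^+ m i) * D ^+ (N - \sum_(i < k) m i).
exists (c *: M + R) => s Ds.
rewrite hornerD RE // mevalD mulrDr; congr (_ + _).
rewrite hornerZ mevalZ mevalX mulrCA; congr (_ * _).
rewrite /M hornerM horner_prod horner_exp.
rewrite -[in RHS](subnK lem) exprD -mulrA mulrC; congr (_ * _).
rewrite -prodrXr -big_split /=; apply: eq_bigr => i _.
by rewrite horner_exp exprMn exprVn mulrCA mulfV ?mulr1 // expf_neq0.
Qed.

(** Substituting a rational curve into a polynomial leaves only powers of the
    denominator of the curve in the denominator. *)
Lemma regular_curve (F : fieldType) n (f : 'M[F]_n -> F)
    (q : 'M[{poly F}]_n) (D : {poly F}) :
  regular_on_SL f ->
  (forall s, D.[s] != 0 -> D.[s]^-1 *: mxeval s q \in SL n F) ->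
  exists N0 : nat, forall N, (N0 <= N)%N -> exists R : {poly F},
    forall s, D.[s] != 0 ->
      R.[s] = D.[s] ^+ N * f (D.[s]^-1 *: mxeval s q).
Proof.
move=> [P Pf] inSL.
have [N0 H] := mpoly_curve P (fun k => mxvec q 0 k) D.
exists N0 => N /H [R RE]; exists R => s Ds.
rewrite RE // Pf ?inSL //; congr (_ * _); apply: meval_eq => k.
case/mxvec_indexP: k => i j.
by rewrite linearZ mxE !mxvecE mxE mulrC.
Qed.

Lemma regular_curve_mx (F : fieldType) n m (R : 'M[F]_n -> 'M[F]_m)
    (q : 'M[{poly F}]_n) (D : {poly F}) :
  (forall i j, regular_on_SL (fun A => R A i j)) ->
  (forall s, D.[s] != 0 -> D.[s]^-1 *: mxeval s q \in SL n F) ->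
  exists N (Q : 'M[{poly F}]_m),
    forall s, D.[s] != 0 ->
      mxeval s Q = D.[s] ^+ N *: R (D.[s]^-1 *: mxeval s q).
Proof.
move=> reg inSL.
have /fin_all_exists [N0 H] (ij : 'I_m * 'I_m) :=
  regular_curve (reg ij.1 ij.2) inSL.
pose N := \max_ij N0 ij.
have /fin_all_exists [Q QE] (ij : 'I_m * 'I_m) := H ij N (leq_bigmax ij).
exists N, (\matrix_(i, j) Q (i, j)) => s Ds.
by apply/matrixP => i j; rewrite mxevalE !mxE (QE (i, j)).
Qed.

Lemma regular_const n (F : fieldType) (c : F) :
  regular_on_SL (fun _ : 'M[F]_n => c).
Proof. by exists c%:MP => A _; rewrite mevalC. Qed.

Lemma regular_entry n (F : fieldType) i j :
  regular_on_SL (fun A : 'M[F]_n => A i j).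
Proof.
by exists 'X_(mxvec_index i j) => A _; rewrite mevalXU mxvecE.
Qed.

Lemma regular_add n (F : fieldType) (f g : 'M[F]_n -> F) :
  regular_on_SL f -> regular_on_SL g -> regular_on_SL (fun A => f A + g A).
Proof.
by move=> [P fP] [Q gQ]; exists (P + Q) => A A1; rewrite mevalD fP ?gQ.
Qed.

Lemma regular_mul n (F : fieldType) (f g : 'M[F]_n -> F) :
  regular_on_SL f -> regular_on_SL g -> regular_on_SL (fun A => f A * g A).
Proof.
by move=> [P fP] [Q gQ]; exists (P * Q) => A A1; rewrite mevalM fP ?gQ.
Qed.

Lemma regular_eq n (F : fieldType) (f g : 'M[F]_n -> F) :
  f =1 g -> regular_on_SL f -> regular_on_SL g.
Proof. by move=> fg [P fP]; exists P => A A1; rewrite -fg fP. Qed.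

Lemma regular_sum n (F : fieldType) (I : Type) (s : seq I) (P : pred I)
    (f : I -> 'M[F]_n -> F) :
  (forall i, regular_on_SL (f i)) ->
  regular_on_SL (fun A => \sum_(i <- s | P i) f i A).
Proof.
move=> reg; elim: s => [|i s IH].
  by apply: regular_eq (regular_const n 0) => A; rewrite big_nil.
have [Pi|nPi] := boolP (P i).
  by apply: regular_eq (regular_add (reg i) IH) => A; rewrite big_cons Pi.
by apply: regular_eq IH => A; rewrite big_cons (negPf nPi).
Qed.

Lemma regular_prod n (F : fieldType) (I : Type) (s : seq I) (P : pred I)
    (f : I -> 'M[F]_n -> F) :
  (forall i, regular_on_SL (f i)) ->
  regular_on_SL (fun A => \prod_(i <- s | P i) f i A).
Proof.
move=> reg; elim: s => [|i s IH].
  by apply: regular_eq (regular_const n 1) => A; rewrite big_nil.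
have [Pi|nPi] := boolP (P i).
  by apply: regular_eq (regular_mul (reg i) IH) => A; rewrite big_cons Pi.
by apply: regular_eq IH => A; rewrite big_cons (negPf nPi).
Qed.

(** * Leading minors and the big cell *)

(** Entries indexed by naturals: the leading minors of all sizes then have no
    dependent indices. *)
Definition nat_entry (R : nmodType) n (A : 'M[R]_n) (i j : nat) : R :=
  if (insub i, insub j) is (Some i', Some j') then A i' j' else 0.

Definition lead_minor (R : comNzRingType) n (k : nat) (A : 'M[R]_n) : R :=
  \det (\matrix_(i < k, j < k) nat_entry A i j).

Lemma nat_entryE (R : nmodType) n (A : 'M[R]_n) (i j : 'I_n) :
  nat_entry A i j = A i j.
Proof. by rewrite /nat_entry !valK. Qed.

Lemma nat_entry_map (R S : comNzRingType) (f : {rmorphism R -> S}) n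
    (A : 'M[R]_n) i j :
  nat_entry (map_mx f A) i j = f (nat_entry A i j).
Proof.
rewrite /nat_entry; case: insub => [i'|]; last by rewrite rmorph0.
by case: insub => [j'|]; rewrite ?rmorph0 // mxE.
Qed.

Lemma lead_minor_full (R : comNzRingType) n (A : 'M[R]_n) :
  lead_minor n A = \det A.
Proof. by congr (\det _); apply/matrixP => i j; rewrite mxE nat_entryE. Qed.

Lemma lead_minor_map (R S : comNzRingType) (f : {rmorphism R -> S}) n k
    (A : 'M[R]_n) :
  lead_minor k (map_mx f A) = f (lead_minor k A).
Proof.
rewrite /lead_minor -det_map_mx; congr (\det _); apply/matrixP => i j.
by rewrite !mxE nat_entry_map.
Qed.

Lemma lead_minor_ulsubmx (R : comNzRingType) n k (A : 'M[R]_(n + 1)) :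
  (k <= n)%N -> lead_minor k (ulsubmx A) = lead_minor k A.
Proof.
move=> lekn; congr (\det _); apply/matrixP => i j; rewrite !mxE.
pose w (x : 'I_k) : 'I_n := widen_ord lekn x.
rewrite -[nat_of_ord i]/(nat_of_ord (w i)) -[nat_of_ord j]/(nat_of_ord (w j)).
rewrite nat_entryE !mxE.
rewrite -[nat_of_ord (w i)]/(nat_of_ord (lshift 1 (w i))).
by rewrite -[nat_of_ord (w j)]/(nat_of_ord (lshift 1 (w j))) nat_entryE.
Qed.

Definition lower_unitriangular n (F : fieldType) (l : 'M[F]_n) : Prop :=
  upper_unitriangular l^T.

Lemma det_upper_unitriangular n (F : fieldType) (u : 'M[F]_n) :
  upper_unitriangular u -> \det u = 1.
Proof.
move=> hu; rewrite -det_tr det_trig.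
  by apply: big1 => i _; rewrite mxE hu // eqxx.
by apply/is_trig_mxP => i j ij; rewrite mxE hu ?(ltnW ij) // -val_eqE /=
  gtn_eqF.
Qed.

Lemma det_lower_unitriangular n (F : fieldType) (l : 'M[F]_n) :
  lower_unitriangular l -> \det l = 1.
Proof. by move/det_upper_unitriangular; rewrite det_tr. Qed.

Lemma upper_unitriangular_block (F : fieldType) n (u : 'M[F]_n)
    (c : 'M[F]_(n, 1)) :
  upper_unitriangular u -> upper_unitriangular (block_mx u c 0 1%:M).
Proof.
move=> hu i j; rewrite -(splitK i) -(splitK j).
case: (split i) => i'; case: (split j) => j' /= ji.
- by rewrite block_mxEul hu // (inj_eq (@lshift_inj _ _)).
- by have := ltn_ord i'; rewrite ltnNge (leq_trans _ ji) // leq_addr.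
- by rewrite block_mxEdl mxE eq_rlshift.
- by rewrite block_mxEdr mxE (inj_eq (@rshift_inj _ _)).
Qed.

(** The big cell: where the leading minors do not vanish, Gaussian elimination
    needs no pivoting. The elimination step is the Schur complement of the
    leading block of corank one. *)
Lemma big_cell (F : fieldType) n (A : 'M[F]_n) :
  (forall k, (0 < k <= n)%N -> lead_minor k A != 0) ->
  exists (l : 'M[F]_n) (t : 'rV[F]_n) (u : 'M[F]_n),
    [/\ lower_unitriangular l, upper_unitriangular u,
        A = l *m diag_mx t *m u &
        forall k, (k <= n)%N ->
          lead_minor k A = \prod_(i < n | (i < k)%N) t 0 i].
Proof.
elim: n A => [|n IH] A.
  move=> _; exists 1%:M, 0, 1%:M; split; try by move=> [].
    by apply/matrixP => -[].
  by move=> k; rewrite leqn0 => /eqP->; rewrite lead_minor_full det_mx00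
    big_ord0.
move: A; rewrite -addn1 => A minors.
have [|l [t [u [hl hu AE minE]]]] := IH (ulsubmx A).
  move=> k /andP[k0 kn]; rewrite lead_minor_ulsubmx // minors // k0.
  by rewrite (leq_trans kn) ?leq_addr.
have dA : \det (ulsubmx A) != 0.
  rewrite -lead_minor_full lead_minor_ulsubmx //.
  have minors0 k : (k <= n)%N -> lead_minor k A != 0.
    case: k => [_|k kn]; first by rewrite /lead_minor det_mx00 oner_neq0.
    by rewrite minors //= (leq_trans kn) ?leq_addr.
  exact: minors0.
have ud : diag_mx t \in unitmx.
  rewrite unitmxE unitfE; move: dA.
  by rewrite AE !det_mulmx !mulf_eq0 !negb_or => /andP[/andP[]].
have ul : l \in unitmx by rewrite unitmxE det_lower_unitriangular // unitr1.
have uu : u \in unitmx by rewrite unitmxE det_upper_unitriangular // unitr1.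
have utu : diag_mx t *m u \in unitmx by rewrite unitmx_mul ud.
have ult : l *m diag_mx t \in unitmx by rewrite unitmx_mul ul.
pose b := invmx (l *m diag_mx t) *m ursubmx A.
pose c := dlsubmx A *m invmx (diag_mx t *m u).
pose d := (drsubmx A - c *m diag_mx t *m b) 0 0.
pose l1 := block_mx l 0 c 1%:M.
pose u1 := block_mx u b 0 1%:M.
pose t1 := row_mx t (d%:M : 'rV_1).
have hl1 : lower_unitriangular l1.
  rewrite /lower_unitriangular /l1 tr_block_mx trmx0 trmx1.
  exact: upper_unitriangular_block.
have hu1 : upper_unitriangular u1 by exact: upper_unitriangular_block.
have AE1 : A = l1 *m diag_mx t1 *m u1.
  rewrite /l1 /u1 /t1 diag_mx_row !mulmx_block.
  rewrite !(mulmx0, mul0mx, mulmx1, mul1mx, addr0, add0r).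
  rewrite -AE /b mulKVmx // /c -[X in block_mx _ _ X _]mulmxA mulmxKV //.
  rewrite -[LHS]submxK; congr block_mx.
  have -> : d%:M = drsubmx A - c *m diag_mx t *m b by rewrite [RHS]mx11_scalar.
  have diag11 (X : 'M[F]_1) : diag_mx X = X.
    by apply/matrixP => i j; rewrite !ord1 mxE eqxx mulr1n.
  by rewrite diag11 -/c -/b addrC subrK.
exists l1, t1, u1; split=> // k kn.
move: kn; rewrite leq_eqVlt => /orP[/eqP->|].
  rewrite lead_minor_full [in LHS]AE1 !det_mulmx (det_lower_unitriangular hl1).
  rewrite (det_upper_unitriangular hu1) mul1r mulr1 det_diag.
  by apply: eq_bigl => i; rewrite ltn_ord.
move=> ltk; have kn : (k <= n)%N by move: ltk; rewrite addn1.
rewrite -lead_minor_ulsubmx // minE //.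
rewrite big_split_ord /= [X in _ = _ * X]big1 ?mulr1.
  by apply: eq_bigr => i _; rewrite /t1 row_mxEl.
by move=> i; rewrite ltnNge (leq_trans kn) ?leq_addr.
Qed.

(** * The minor product on SL_(r+1) *)

(** The function on SL_(r+1) that the highest weight lambda determines: the
    matrix coefficient of L(lambda) at a highest weight vector and a functional
    fixed by the lower unitriangular group. *)
Definition minor_product (R : comNzRingType) r (lambda : dominant_weight r)
    (A : 'M[R]_r.+1) : R :=
  \prod_(j < r) lead_minor j.+1 A ^+ lambda j.

Lemma minor_product_map (R S : comNzRingType) (f : {rmorphism R -> S}) r
    (lambda : dominant_weight r) (A : 'M[R]_r.+1) :
  minor_product lambda (map_mx f A) = f (minor_product lambda A).
Proof.
rewrite rmorph_prod; apply: eq_bigr => j _.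
by rewrite rmorphXn lead_minor_map.
Qed.

Lemma lead_minor_eval (F : fieldType) n k s (A : 'M[{poly F}]_n) :
  lead_minor k (mxeval s A) = (lead_minor k A).[s].
Proof. exact: lead_minor_map. Qed.

Lemma minor_product_eval (F : fieldType) r (lambda : dominant_weight r) s
    (A : 'M[{poly F}]_r.+1) :
  minor_product lambda (mxeval s A) = (minor_product lambda A).[s].
Proof. exact: minor_product_map. Qed.

Definition first_row_scaling (R : comNzRingType) r (d : R) : 'M[R]_r.+1 :=
  diag_mx (\row_i if i == 0 then d else 1).

Lemma det_first_row_scaling (R : comNzRingType) r (d : R) :
  \det (first_row_scaling r d) = d.
Proof.
rewrite det_diag big_ord_recl mxE eqxx big1 ?mulr1 // => i _.
by rewrite mxE.
Qed.

Lemma lead_minor_first_row (R : comNzRingType) r (d : R) (B : 'M[R]_r.+1) k :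
  (0 < k <= r.+1)%N ->
  lead_minor k (first_row_scaling r d *m B) = d * lead_minor k B.
Proof.
case: k => // k /= kr; rewrite /lead_minor.
rewrite -[X in _ = X * _](det_first_row_scaling k).
rewrite -det_mulmx; congr (\det _); apply/matrixP => i j.
rewrite !mul_diag_mx !mxE.
pose w (x : 'I_k.+1) : 'I_r.+1 := widen_ord kr x.
rewrite -[nat_of_ord i]/(nat_of_ord (w i)) -[nat_of_ord j]/(nat_of_ord (w j)).
by rewrite !nat_entryE !mxE.
Qed.

Lemma lead_minor1 (R : comNzRingType) n k :
  (k <= n)%N -> lead_minor k (1%:M : 'M[R]_n) = 1.
Proof.
move=> kn; rewrite -[RHS](det1 R k); congr (\det _); apply/matrixP => i j.
rewrite !mxE; pose w (x : 'I_k) : 'I_n := widen_ord kn x.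
rewrite -[nat_of_ord i]/(nat_of_ord (w i)) -[nat_of_ord j]/(nat_of_ord (w j)).
by rewrite nat_entryE mxE.
Qed.

(** The big cell is dense: a matrix g of SL is joined to 1 by the segment
    (1 - s) g + s, which is brought back to SL by dividing its first row by its
    determinant, and which lies in the big cell for almost all s. *)
Lemma big_cell_dense (F : closedFieldType) r (lambda : dominant_weight r)
    (f : 'M[F]_r.+1 -> F) (c : F) :
  regular_on_SL f ->
  (forall g, g \in SL r.+1 F ->
    (forall k, (0 < k <= r.+1)%N -> lead_minor k g != 0) ->
    f g = c * minor_product lambda g) ->
  forall g, g \in SL r.+1 F -> f g = c * minor_product lambda g.
Proof.
move=> reg cell g gSL.
pose G : 'M[{poly F}]_r.+1 :=
  map_mx polyC g + 'X *: (1%:M - map_mx polyC g).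
have G0 : mxeval 0 G = g.
  by apply/matrixP => i j; rewrite !mxE /horner_eval !hornerE.
have G1 : mxeval 1 G = 1%:M.
  apply/matrixP => i j; rewrite !mxE /horner_eval.
  by case: eqP => _; rewrite !hornerE /=; ring.
pose D := \det G.
have D0 : D.[0] = 1 by rewrite -det_mxeval G0; apply/eqP; move: gSL;
  rewrite inE.
pose dq : 'M[{poly F}]_r.+1 := diag_mx (\row_i if i == 0 then 1 else D) *m G.
have qE s : D.[s] != 0 ->
    D.[s]^-1 *: mxeval s dq = first_row_scaling r D.[s]^-1 *m mxeval s G.
  move=> Ds; apply/matrixP => i j.
  rewrite /dq /first_row_scaling !mul_diag_mx !mxE /horner_eval hornerM.
  by case: eqP => _; rewrite ?hornerC ?mul1r // mulrA mulVf ?mul1r.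
have inSL s : D.[s] != 0 -> D.[s]^-1 *: mxeval s dq \in SL r.+1 F.
  move=> Ds; rewrite qE // inE det_mulmx det_first_row_scaling det_mxeval.
  by rewrite mulVf.
have [N /(_ _ (leqnn _)) [R RE]] := regular_curve reg inSL.
pose a := (\sum_(j < r) lambda j)%N.
pose z := D * \prod_(k < r.+1) lead_minor k.+1 G.
have zn0 : z != 0.
  apply: contraTneq (oner_neq0 F) => z0; rewrite negbK; apply/eqP.
  rewrite -[RHS](horner0 1) -z0 hornerM -det_mxeval G1 det1 mul1r.
  rewrite horner_prod big1 // => k _.
  by rewrite -lead_minor_eval G1 lead_minor1.
have key : R * D ^+ a = c *: (D ^+ N * minor_product lambda G).
  apply: poly_generic_eq zn0 _ => s; rewrite hornerM mulf_eq0 negb_or.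
  case/andP=> Ds ms.
  have ms' k : (0 < k <= r.+1)%N -> (lead_minor k G).[s] != 0.
    case: k => //= k kr; apply: contraNneq ms => m0.
    rewrite horner_prod (bigD1 (Ordinal kr)) //=.
    by rewrite [X in X * _]m0 mul0r.
  rewrite hornerM hornerZ hornerM !horner_exp RE // cell ?inSL //; last first.
    move=> k kr; rewrite qE // lead_minor_first_row // mulf_neq0 ?invr_eq0 //.
    by rewrite lead_minor_eval ms'.
  have -> : minor_product lambda (D.[s]^-1 *: mxeval s dq) =
            D.[s] ^- a * (minor_product lambda G).[s].
    rewrite -minor_product_eval /minor_product -exprVn -prodrXr -big_split /=.
    apply: eq_bigr => j _; rewrite qE // lead_minor_first_row ?exprMn //.
    by rewrite /= ltnS ltnW.
  have Da : D.[s] ^+ a != 0 by rewrite expf_neq0.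
  by field.
have := congr1 (horner^~ 0) key.
rewrite hornerM hornerZ hornerM !horner_exp D0 !expr1n mulr1 mul1r.
rewrite -minor_product_eval G0 => <-.
have D0n : D.[0] != 0 by rewrite D0 oner_neq0.
rewrite RE // qE // D0 expr1n mul1r invr1 G0; congr f.
by apply/matrixP => i j; rewrite mul_diag_mx !mxE if_same mul1r.
Qed.

(** * Spectral projections of a one-parameter group of matrices *)

Definition coef_mx (R : nzRingType) m n (k : nat) (Q : 'M[{poly R}]_(m, n)) :
  'M[R]_(m, n) := \matrix_(i, j) (Q i j)`_k.

Lemma mxeval_generic_eq (F : closedFieldType) m n (P Q : 'M[{poly F}]_(m, n)) :
  (forall s, s != 0 -> mxeval s P = mxeval s Q) -> P = Q.
Proof.
move=> PQ; apply/matrixP => i j.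
apply: (@poly_generic_eq _ 'X); first by rewrite polyX_eq0.
by move=> s; rewrite hornerX => /PQ/matrixP/(_ i j); rewrite !mxE.
Qed.

Lemma coef_mxM (F : fieldType) m n q k (A : 'M[F]_(m, n))
    (Q : 'M[{poly F}]_(n, q)) :
  coef_mx k (map_mx polyC A *m Q) = A *m coef_mx k Q.
Proof.
apply/matrixP => i j; rewrite !mxE coef_sum; apply: eq_bigr => l _.
by rewrite !mxE coefCM.
Qed.

Lemma coef_mxMr (F : fieldType) m n q k (A : 'M[F]_(n, q))
    (Q : 'M[{poly F}]_(m, n)) :
  coef_mx k (Q *m map_mx polyC A) = coef_mx k Q *m A.
Proof.
apply/matrixP => i j; rewrite !mxE coef_sum; apply: eq_bigr => l _.
by rewrite !mxE coefMC.
Qed.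

Definition subst_scale (R : nzRingType) (s : R) (p : {poly R}) : {poly R} :=
  \poly_(i < size p) (p`_i * s ^+ i).

Lemma coef_subst_scale (R : nzRingType) (s : R) p k :
  (subst_scale s p)`_k = p`_k * s ^+ k.
Proof.
by rewrite coef_poly; case: ltnP => // sp; rewrite nth_default // mul0r.
Qed.

Lemma horner_subst_scale (R : comNzRingType) (s x : R) p :
  (subst_scale s p).[x] = p.[x * s].
Proof.
rewrite horner_poly [RHS]horner_coef; apply: eq_bigr => i _.
by rewrite exprMn mulrA mulrAC.
Qed.

(** Comparison of coefficients of x in Q(x) Q(s) = Q(x s): the coefficients of a
    one-parameter group of matrices are its spectral projections. *)
Lemma coef_mx_projection (F : closedFieldType) m (Q : 'M[{poly F}]_m) k s :
  (forall x y, x != 0 -> y != 0 ->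
    mxeval x Q *m mxeval y Q = mxeval (x * y) Q) ->
  s != 0 -> coef_mx k Q *m mxeval s Q = s ^+ k *: coef_mx k Q.
Proof.
move=> QM sn0; rewrite -coef_mxMr.
have -> : Q *m map_mx polyC (mxeval s Q) = map_mx (subst_scale s) Q.
  apply: mxeval_generic_eq => x xn0; rewrite mxevalM mxevalC QM //.
  by apply/matrixP => i j; rewrite !mxE /horner_eval horner_subst_scale.
by apply/matrixP => i j; rewrite !mxE coef_subst_scale mulrC.
Qed.

(** Rows taken from distinct spectral projections are linearly independent,
    because each projection kills the rows of the others. *)
Lemma coef_mx_count (F : closedFieldType) m (Q : 'M[{poly F}]_m) (ks : seq nat)
  :
  (forall x y, x != 0 -> y != 0 ->
    mxeval x Q *m mxeval y Q = mxeval (x * y) Q) ->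
  uniq ks -> (forall k, k \in ks -> coef_mx k Q != 0) -> (size ks <= m)%N.
Proof.
move=> QM ks_uniq ks_n0.
pose k_ (a : 'I_(size ks)) := nth 0%N ks a.
have /fin_all_exists [i_ w_n0] (a : 'I_(size ks)) :
    exists i, row i (coef_mx (k_ a) Q) != 0.
  apply/existsP; have := ks_n0 _ (mem_nth 0%N (ltn_ord a)).
  apply: contraNT; rewrite negb_exists => /forallP rows0.
  by apply/eqP/row_matrixP => i; rewrite row0; apply/eqP/negPn/rows0.
pose W := \matrix_a row (i_ a) (coef_mx (k_ a) Q).
have Wk a b : row a W *m coef_mx (k_ b) Q = (a == b)%:R *: row a W.
  have HQ : map_mx polyC (row a W) *m Q = 'X^(k_ a) *: map_mx polyC (row a W).
    apply: mxeval_generic_eq => s sn0.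
    rewrite mxevalM mxevalC rowK -row_mul coef_mx_projection //.
    apply/matrixP => i j; by rewrite !mxE /horner_eval hornerM hornerXn hornerC.
  rewrite -coef_mxM HQ; apply/matrixP => i j.
  rewrite !mxE mulrC coefCM coefXn mulrC; congr (_%:R * _).
  by rewrite (nth_uniq 0%N) // eq_sym.
rewrite -[size ks]/(size ks) (leq_trans _ (rank_leq_col W)) // row_leq_rank.
rewrite -kermx_eq0; apply/eqP/row_matrixP => x; rewrite row0.
have := mulmx_ker W; move/(congr1 (row x)); rewrite row_mul row0.
set y := row x _; rewrite mulmx_sum_row => yW; apply/rowP => b;
  rewrite [RHS]mxE.
have := congr1 (fun M => M *m coef_mx (k_ b) Q) yW.
rewrite mul0mx mulmx_suml (bigD1 b) //= big1 ?addr0; last first.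
  by move=> a ab; rewrite -scalemxAl Wk (negPf ab) scale0r scaler0.
rewrite -scalemxAl Wk eqxx scale1r => /eqP; rewrite scaler_eq0 =>
  /orP[/eqP->//|].
by rewrite rowK (negPf (w_n0 b)).
Qed.

(** * Tori and weights *)

Lemma SL_mul n (F : fieldType) (A B : 'M[F]_n) :
  A \in SL n F -> B \in SL n F -> A *m B \in SL n F.
Proof.
by rewrite !inE det_mulmx => /eqP-> /eqP->; rewrite mulr1.
Qed.

Lemma SL1 n (F : fieldType) : 1%:M \in SL n F.
Proof. by rewrite inE det1. Qed.

Definition torus_num (R : nzRingType) r (e : 'I_r.+1 -> nat) :
  'M[{poly R}]_r.+1 := diag_mx (\row_i 'X^(e i)).

(** The torus element diag(s^(e i - c)), written with a polynomial numerator: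
    its exponents sum to zero in SL, so they are not all positive. *)
Definition torus (F : fieldType) r (e : 'I_r.+1 -> nat) c (s : F) :
  'M[F]_r.+1 := ('X^c).[s]^-1 *: mxeval s (torus_num F e).

Lemma torusE (F : fieldType) r (e : 'I_r.+1 -> nat) c (s : F) :
  torus e c s = diag_mx (\row_i (s ^- c * s ^+ e i)).
Proof.
apply/matrixP => i j; rewrite !mxE /horner_eval hornerXn hornerMn hornerXn.
by rewrite mulrnAr.
Qed.

Lemma torusM (F : fieldType) r (e : 'I_r.+1 -> nat) c (s t : F) :
  torus e c s *m torus e c t = torus e c (s * t).
Proof.
rewrite !torusE mulmx_diag; congr diag_mx; apply/rowP => i; rewrite !mxE.
by rewrite !exprMn invfM mulrACA.
Qed.

Lemma torus1 (F : fieldType) r (e : 'I_r.+1 -> nat) c :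
  torus e c 1 = 1%:M :> 'M[F]_r.+1.
Proof.
by rewrite torusE; apply/matrixP => i j; rewrite !mxE !expr1n invr1 mulr1.
Qed.

Lemma torus_SL (F : fieldType) r (e : 'I_r.+1 -> nat) c (s : F) :
  (\sum_i e i = r.+1 * c)%N -> s != 0 -> torus e c s \in SL r.+1 F.
Proof.
move=> ec sn0; rewrite inE torusE det_diag.
rewrite (eq_bigr (fun i => s ^- c * s ^+ e i)); last by move=> i _; rewrite mxE.
rewrite big_split /= prodr_const card_ord prodrXr ec -exprVn -exprM mulnC.
by rewrite -exprMn mulVf // expr1n.
Qed.

(** The monomial t^nu occurs in some translate of the minor product, which makes
    nu a weight of the irreducible module. Only the one-parameter subgroups
    t_i = s^(e i) are tested, but all of them: one variable is then enough. *)
Definition torus_weight (F : fieldType) r (lambda : dominant_weight r)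
    (nu : 'I_r.+1 -> nat) : Prop :=
  forall e : 'I_r.+1 -> nat, exists x g : 'M[F]_r.+1,
    [/\ x \in SL r.+1 F, g \in SL r.+1 F &
        (minor_product lambda (map_mx polyC x *m torus_num F e
           *m map_mx polyC g))`_(\sum_i nu i * e i) != 0].

Lemma digits_inj n B (f g : 'I_n -> nat) :
  (forall i, f i < B)%N -> (forall i, g i < B)%N ->
  (\sum_i f i * B ^ i = \sum_i g i * B ^ i)%N -> f =1 g.
Proof.
elim: n f g => [|n IH] f g fB gB; first by move=> _ [].
rewrite !big_ord_recl /= !expn0 !muln1.
have shift (h : 'I_n.+1 -> nat) :
    (\sum_(i < n) h (lift ord0 i) * B ^ bump 0 i =
     (\sum_(i < n) h (lift ord0 i) * B ^ i) * B)%N.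
  by rewrite big_distrl /=; apply: eq_bigr => i _; rewrite -mulnA -expnSr.
rewrite !shift => E.
have E0 : f ord0 = g ord0.
  by have := congr1 (modn^~ B) E; rewrite /= ![(_ + _ * B)%N]addnC !modnMDl
    !modn_small.
have B0 : (0 < B)%N by exact: leq_ltn_trans (fB ord0).
have /IH E1 : (\sum_(i < n) f (lift ord0 i) * B ^ i =
               \sum_(i < n) g (lift ord0 i) * B ^ i)%N.
  by apply/eqP; rewrite -(eqn_pmul2r B0) -(eqn_add2l (f ord0)) E E0.
move=> i; case: (unliftP ord0 i) => [j|] -> //.
by apply: E1 => k; [exact: fB | exact: gB].
Qed.

(** * Counting weights in a representation by matrices *)

Lemma minor_product_scale (R : comNzRingType) r (lambda : dominant_weight r)
    (a : R) (A : 'M[R]_r.+1) :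
  minor_product lambda (a *: A) =
    a ^+ (\sum_(j < r) j.+1 * lambda j) * minor_product lambda A.
Proof.
rewrite -prodrXr -big_split; apply: eq_bigr => j _ /=.
rewrite exprM -exprMn; congr (_ ^+ _); rewrite -detZ; congr (\det _).
apply/matrixP => i k; rewrite !mxE /nat_entry.
by case: insub => [i'|]; [case: insub => [k'|]|]; rewrite ?mulr0 ?mxE.
Qed.

Section MatrixRepresentation.

Variables (F : closedFieldType) (r m : nat) (R : 'M[F]_r.+1 -> 'M[F]_m).
Variables (lambda : dominant_weight r) (v : 'cV[F]_m).

Hypothesis R1 : R 1%:M = 1%:M.
Hypothesis RM : {in SL r.+1 F &, forall A B, R (A *m B) = R A *m R B}.
Hypothesis R_regular : forall i j, regular_on_SL (fun A => R A i j).
Hypothesis v_neq0 : v != 0.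
Hypothesis v_unipotent : forall u, upper_unitriangular u -> R u *m v = v.
Hypothesis v_torus : forall t : 'rV[F]_r.+1, diag_mx t \in SL r.+1 F ->
  R (diag_mx t) *m v = weight_character lambda t *: v.
Hypothesis v_cogenerates : forall phi : 'rV[F]_m,
  (forall g, g \in SL r.+1 F -> phi *m R g *m v = 0) -> phi = 0.

Lemma torus_curve (e : 'I_r.+1 -> nat) c :
  (0 < c)%N -> (\sum_i e i = r.+1 * c)%N ->
  exists N (Q : 'M[{poly F}]_m), forall s : F, s != 0 ->
    mxeval s Q = s ^+ N *: R (torus e c s).
Proof.
move=> c0 ec; have Xc s : s != 0 -> ('X^c : {poly F}).[s] != 0.
  by move=> sn0; rewrite hornerXn expf_neq0.
have inSL s : ('X^c : {poly F}).[s] != 0 -> torus e c s \in SL r.+1 F.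
  move=> sn0; apply: torus_SL => //; apply: contraNneq sn0 => ->.
  by rewrite hornerXn expr0n (gtn_eqF c0).
have [N [Q QE]] := regular_curve_mx R_regular inSL.
exists (c * N)%N, Q => s /Xc/QE ->; congr (_ *: _).
by rewrite hornerXn exprM.
Qed.

Section Torus.

Variables (e : 'I_r.+1 -> nat) (c N : nat) (Q : 'M[{poly F}]_m).
Hypothesis ec : (\sum_i e i = r.+1 * c)%N.
Hypothesis e_dec : forall i j : 'I_r.+1, (i < j)%N -> (e j < e i)%N.
Hypothesis QE : forall s : F, s != 0 -> mxeval s Q = s ^+ N *: R (torus e c s).

Lemma torus_curve_mul x y : x != 0 -> y != 0 ->
  mxeval x Q *m mxeval y Q = mxeval (x * y) Q.
Proof.
move=> xn0 yn0; rewrite !QE ?mulf_neq0 // -scalemxAl -scalemxAr scalerA.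
by rewrite -exprMn -RM ?torus_SL // torusM.
Qed.

(** Q is not zero, since Q(1) is R 1 = 1. *)
Lemma top_degree :
  exists K, coef_mx K Q != 0 /\ forall i j, (size (Q i j) <= K.+1)%N.
Proof.
have m0 : (0 < #|{: 'I_m * 'I_m}|)%N.
  case: (m) v v_neq0 => [|m'] w; last by rewrite card_prod !card_ord.
  by rewrite [w]flatmx0 eqxx.
have [[i j] Mij] := eq_bigmax (fun ij => size (Q ij.1 ij.2)) m0.
have le_size i' j' : (size (Q i' j') <= size (Q i j))%N.
  rewrite -[size (Q i j)]Mij.
  exact: (leq_bigmax (F := fun ij => size (Q ij.1 ij.2)) (i', j')).
have Qij : Q i j != 0.
  apply: contraNneq v_neq0 => Q0; apply/eqP.
  have Q_eq0 : Q = 0.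
    apply/matrixP => i' j'; have := le_size i' j'.
    by rewrite Q0 size_poly0 leqn0 size_poly_eq0 mxE => /eqP.
  have := QE (oner_neq0 F); rewrite torus1 expr1n scale1r R1 Q_eq0 => E.
  rewrite -[v]mul1mx -E; apply/matrixP => i' j'; rewrite !mxE big1 // => k _.
  by rewrite !mxE /horner_eval horner0 mul0r.
exists (size (Q i j)).-1; split=> [|i' j'].
  apply: contra_neq Qij => /matrixP/(_ i j); rewrite !mxE => /eqP.
  by rewrite lead_coef_eq0 => /eqP.
by rewrite prednK ?le_size // size_poly_gt0.
Qed.

(** The torus contracts the lower unitriangular group to 1, so that group fixes
    the rows of the top spectral projection. *)
Lemma top_projection_lower K l :
  (forall i j, (size (Q i j) <= K.+1)%N) -> lower_unitriangular l ->
  coef_mx K Q *m R l = coef_mx K Q.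
Proof.
move=> Ksize hl.
pose lz : 'M[{poly F}]_r.+1 := \matrix_(i, j) (l i j *: 'X^(e j - e i)%N).
have l0 (i j : 'I_r.+1) : (i <= j)%N -> l i j = (i == j)%:R.
  by move=> ij; have := hl j i ij; rewrite mxE eq_sym.
have lz_low s : lower_unitriangular (mxeval s lz).
  move=> i j ji; rewrite !mxE /horner_eval hornerZ hornerXn l0 //.
  by rewrite (eq_sym j); case: eqP => [->|_]; rewrite ?subnn ?mulr1 ?mul0r.
have SLlow A : lower_unitriangular A -> A \in SL r.+1 F.
  by move=> hA; rewrite inE det_lower_unitriangular.
have inSL s : (1 : {poly F}).[s] != 0 ->
    (1 : {poly F}).[s]^-1 *: mxeval s lz \in SL r.+1 F.
  by move=> _; rewrite hornerC invr1 scale1r SLlow.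
have [N' [C CE]] := regular_curve_mx R_regular inSL.
have {}CE s : mxeval s C = R (mxeval s lz).
  by rewrite CE hornerC ?oner_neq0 // invr1 expr1n !scale1r.
(* Q(1/z) z^K, whose value at z = 0 is the coefficient of degree K. *)
pose Qrev : 'M[{poly F}]_m :=
  \matrix_(i, j) \poly_(k < K.+1) (Q i j)`_(K - k).
have QrevE z : z != 0 -> mxeval z Qrev = z ^+ K *: mxeval z^-1 Q.
  move=> zn0; apply/matrixP => i j; rewrite !mxE /horner_eval horner_poly.
  rewrite (horner_coef_wide _ (Ksize i j)) mulr_sumr (reindex_inj rev_ord_inj).
  apply: eq_bigr => k _ /=; have kK : (k <= K)%N by rewrite -ltnS.
  rewrite subSS subKn // mulrCA; congr (_ * _).
  by rewrite -[X in _ = z ^+ X * _](subnK kK) exprD -mulrA -exprMn mulfV //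
    expr1n mulr1.
have eqQ : Qrev *m map_mx polyC (R l) = C *m Qrev.
  apply: mxeval_generic_eq => z zn0; rewrite !mxevalM mxevalC QrevE // CE.
  rewrite -scalemxAl -scalemxAr; congr (_ *: _).
  have zV : z^-1 != 0 by rewrite invr_eq0.
  rewrite QE // -scalemxAl -scalemxAr; congr (_ *: _).
  rewrite -!RM ?torus_SL // ?SLlow //; congr R.
  rewrite torusE mul_diag_mx mul_mx_diag; apply/matrixP => i j; rewrite !mxE.
  rewrite /horner_eval hornerZ hornerXn.
  have [ij|ji] := leqP i j.
    rewrite l0 //; case: eqP => [->|_]; last by rewrite mulr0 !mul0r.
    by rewrite subnn expr0 mulr1 mulrC.
  have /ltnW eij := e_dec ji.
  have -> : z^-1 ^+ e i = z ^+ (e j - e i) * z^-1 ^+ e j.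
    by rewrite -[in RHS](subnK eij) addnK exprD mulrA -exprMn mulfV // expr1n
      mul1r.
  by ring.
have := congr1 (mxeval 0) eqQ; rewrite !mxevalM mxevalC CE.
have -> : mxeval 0 lz = 1%:M.
  apply/matrixP => i j; rewrite !mxE /horner_eval hornerZ hornerXn.
  have [ij|ji] := leqP i j.
    rewrite l0 //; case: eqP => [->|_]; last by rewrite mul0r.
    by rewrite subnn expr0 mulr1.
  rewrite expr0n subn_eq0 leqNgt (e_dec ji) mulr0 -val_eqE /=.
  by rewrite gtn_eqF.
rewrite R1 mul1mx.
have -> // : mxeval 0 Qrev = coef_mx K Q.
by apply/matrixP => i j; rewrite !mxE /horner_eval horner_coef0 coef_poly subn0.
Qed.

End Torus.

(** Exponents of a torus curve with these values separate the weights whose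
    entries are smaller than B; the factor r + 1 lets them sum to a multiple of
    r + 1. *)
Definition digit_exponent B (i : 'I_r.+1) : nat := (r.+1 * B ^ rev_ord i)%N.

Lemma sum_digit_exponent B :
  (\sum_i digit_exponent B i = r.+1 * \sum_(i < r.+1) B ^ i)%N.
Proof.
by rewrite -big_distrr /= [in RHS](reindex_inj rev_ord_inj).
Qed.

Lemma digit_exponent_dec B : (1 < B)%N ->
  forall i j : 'I_r.+1, (i < j)%N -> (digit_exponent B j < digit_exponent B
    i)%N.
Proof.
move=> B1 i j ij; rewrite ltn_pmul2l // ltn_exp2l //= ltn_sub2l //.
by rewrite ltnS (leq_trans ij) // -ltnS.
Qed.

Lemma torus_curve_digits B : (1 < B)%N ->
  exists N (Q : 'M[{poly F}]_m), forall s : F, s != 0 ->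
    mxeval s Q =
      s ^+ N *: R (torus (digit_exponent B) (\sum_(i < r.+1) B ^ i) s).
Proof.
move=> B1; apply: torus_curve; last exact: sum_digit_exponent.
by rewrite big_ord_recl addn_gt0 expn_gt0 ltnW.
Qed.

(** A nonzero row of the top spectral projection is such a functional. *)
Lemma exists_lowest_functional :
  exists phi : 'rV[F]_m, phi != 0 /\
    forall l, lower_unitriangular l -> phi *m R l = phi.
Proof.
have [N [Q QE]] := torus_curve_digits (isT : 1 < 2)%N.
have [K [QK Qsize]] := top_degree QE.
have /existsP [i rowi] : [exists i, row i (coef_mx K Q) != 0].
  apply: contraNT QK; rewrite negb_exists => /forallP rows0.
  by apply/eqP/row_matrixP => i; rewrite row0; apply/eqP/negPn/rows0.
exists (row i (coef_mx K Q)); split=> // l hl; rewrite -row_mul.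
congr row; apply: top_projection_lower QE _ _ _ _ => //.
  exact: sum_digit_exponent.
exact: digit_exponent_dec.
Qed.

Lemma weight_character_minor (g : 'M[F]_r.+1) (t : 'rV[F]_r.+1) :
  (forall k, (k <= r.+1)%N ->
    lead_minor k g = \prod_(i < r.+1 | (i < k)%N) t 0 i) ->
  weight_character lambda t = minor_product lambda g.
Proof.
by move=> gt; apply: eq_bigr => j _; rewrite gt // ltnS ltnW.
Qed.

(** On the big cell g = l t u the functional absorbs l, the vector absorbs u,
    and t acts on v through lambda. *)
Lemma matrix_coefficient (phi : 'rV[F]_m) :
  (forall l, lower_unitriangular l -> phi *m R l = phi) ->
  forall g, g \in SL r.+1 F ->
    (phi *m R g *m v) 0 0 = (phi *m v) 0 0 * minor_product lambda g.
Proof.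
move=> phi_low; apply: (@big_cell_dense _ _ _ (fun g => (phi *m R g *m v) 0 0)).
  apply: (@regular_eq _ _
    (fun g => \sum_j (\sum_i phi 0 i * R g i j) * v j 0)) => [A|].
    by rewrite mxE; apply: eq_bigr => j _; rewrite mxE.
  apply: regular_sum => j; apply: regular_mul (regular_const _ _).
  by apply: regular_sum => i; apply: regular_mul (regular_const _ _) _.
move=> g gSL /big_cell [l [t [u [hl hu gE minE]]]].
have lSL : l \in SL r.+1 F by rewrite inE det_lower_unitriangular.
have uSL : u \in SL r.+1 F by rewrite inE det_upper_unitriangular.
have tSL : diag_mx t \in SL r.+1 F.
  move: gSL; rewrite !inE gE !det_mulmx (det_lower_unitriangular hl).
  by rewrite (det_upper_unitriangular hu) mul1r mulr1.
rewrite [in R g]gE !RM ?SL_mul // -!mulmxA v_unipotent // v_torus //.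
rewrite mulmxA phi_low // -scalemxAr mxE mulrC; congr (_ * _).
exact: weight_character_minor.
Qed.

Lemma functional_max_vector_neq0 (phi : 'rV[F]_m) :
  phi != 0 -> (forall l, lower_unitriangular l -> phi *m R l = phi) ->
  (phi *m v) 0 0 != 0.
Proof.
move=> phi_n0 phi_low; apply: contraNneq phi_n0 => phiv; apply/eqP.
apply: v_cogenerates => g gSL; apply/matrixP => i j; rewrite !ord1.
by rewrite matrix_coefficient // phiv mul0r mxE.
Qed.

(** The dimension is at least the number of weights: distinct weights give
    distinct powers of s on a torus curve whose exponents are the digit values
    of a base exceeding all entries. *)
Lemma weights_leq_dim (nus : seq {ffun 'I_r.+1 -> nat}) :
  uniq nus -> (forall nu, nu \in nus -> torus_weight F lambda nu) ->
  (size nus <= m)%N.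
Proof.
move=> nus_uniq nus_wt.
pose B := (2 + \sum_(nu <- nus) \sum_i nu i)%N.
have nuB nu i : nu \in nus -> (nu i < B)%N.
  move=> nu_in; rewrite /B (big_rem nu) //= (bigD1 i) //=; lia.
have B1 : (1 < B)%N by rewrite /B; lia.
have [N [Q QE]] := torus_curve_digits B1.
set e := digit_exponent B in QE; set c := (\sum_(i < r.+1) B ^ i)%N in QE.
have ec : (\sum_i e i = r.+1 * c)%N by exact: sum_digit_exponent.
have [phi [phi_n0 phi_low]] := exists_lowest_functional.
have phiv := functional_max_vector_neq0 phi_n0 phi_low.
pose L := (\sum_(j < r) j.+1 * lambda j)%N.
pose E (nu : {ffun 'I_r.+1 -> nat}) := (\sum_i nu i * e i)%N.
have weight_degree nu : nu \in nus ->
    (c * L <= E nu + N)%N /\ coef_mx (E nu + N - c * L) Q != 0.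
  move=> /nus_wt/(_ e) [x [g [xSL gSL]]].
  set T := minor_product _ _ => Tn0.
  (* The denominators of Q and of the torus shift degrees by N and c L. *)
  pose H := (map_mx polyC (phi *m R x) *m Q *m map_mx polyC (R g *m v)) 0 0.
  have HE : H * 'X^(c * L) = (phi *m v) 0 0 *: ('X^N * T).
    apply: (@poly_generic_eq _ 'X); first by rewrite polyX_eq0.
    move=> s; rewrite hornerX => sn0.
    rewrite hornerM hornerZ hornerM !hornerXn -minor_product_eval !mxevalM.
    rewrite !mxevalC -mxevalE !mxevalM !mxevalC QE // -scalemxAr -scalemxAl mxE.
    have -> : phi *m R x *m R (torus e c s) *m (R g *m v) =
        phi *m R (x *m torus e c s *m g) *m v.
      by rewrite !RM ?SL_mul ?torus_SL // !mulmxA.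
    rewrite matrix_coefficient ?SL_mul ?torus_SL //.
    have -> : minor_product lambda (x *m torus e c s *m g) =
       s ^- (c * L) * minor_product lambda (x *m (mxeval s (torus_num F e) *m
         g)).
      rewrite /torus hornerXn -scalemxAr -scalemxAl -mulmxA.
      by rewrite minor_product_scale -/L -exprVn -exprM exprVn.
    have sc : s ^+ (c * L) != 0 by rewrite expf_neq0.
    by rewrite mulmxA; field.
  have := congr1 (fun p : {poly F} => p`_(E nu + N)) HE.
  have NE : (E nu + N < N)%N = false by lia.
  rewrite coefZ coefXnM coefMXn addnK NE.
  case: ltnP => [_ /eqP|le_cL HT].
    by rewrite eq_sym mulf_eq0 (negPf phiv) (negPf Tn0).
  split=> //; apply: contraNneq Tn0 => Q0.
  suff H0 : H`_(E nu + N - c * L) = 0.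
    by move/esym/eqP: HT; rewrite H0 mulf_eq0 (negPf phiv).
  transitivity (coef_mx (E nu + N - c * L) (map_mx polyC (phi *m R x) *m Q *m
    map_mx polyC (R g *m v)) 0 0).
    by rewrite [RHS]mxE.
  by rewrite coef_mxMr coef_mxM Q0 mulmx0 mul0mx mxE.
rewrite -(size_map (fun nu => E nu + N - c * L)%N).
apply: (@coef_mx_count _ _ Q).
- exact: torus_curve_mul ec QE.
- rewrite map_inj_in_uniq // => nu nu' nu_in nu_in' Enu.
  have [le _] := weight_degree nu nu_in.
  have [le' _] := weight_degree nu' nu_in'.
  have {le le'} EE : E nu = E nu' by lia.
  apply/ffunP => i; rewrite -[i]rev_ordK.
  apply: (@digits_inj r.+1 B (nu \o (@rev_ord _)) (nu' \o (@rev_ord _))).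
  + by move=> j; apply: nuB.
  + by move=> j; apply: nuB.
  apply/eqP; rewrite -(eqn_pmul2l (ltn0Sn r)); apply/eqP.
  rewrite !big_distrr /=; have := EE; rewrite /E.
  rewrite (reindex_inj rev_ord_inj) [in RHS](reindex_inj rev_ord_inj) /=.
  rewrite /e /digit_exponent => EE'.
  by under eq_bigr do rewrite mulnCA; under [RHS]eq_bigr do rewrite mulnCA;
    move: EE'; under eq_bigr do rewrite rev_ordK;
    under [X in _ = X -> _]eq_bigr do rewrite rev_ordK.
- by move=> k /mapP[nu nu_in ->]; have [_] := weight_degree nu nu_in.
Qed.

End MatrixRepresentation.

(** * Irreducible rational representations *)

(** The subspaces contained in P have bounded dimension, and one of largest
    dimension is all of P. *)
Lemma definable_subspace (K : fieldType) (V : vectType K) (P : V -> Prop) :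
  P 0 -> (forall a u w, P u -> P w -> P (a *: u + w)) ->
  exists U : {vspace V}, forall u, u \in U <-> P u.
Proof.
move=> P0 Plin.
suff H k (U : {vspace V}) : (forall u, u \in U -> P u) ->
    (\dim {:V} - \dim U <= k)%N -> exists U : {vspace V}, forall u, u \in U <->
      P u.
  by apply: (H _ 0%VS _ (leqnn _)) => u; rewrite memv0 => /eqP->.
elim: k U => [|k IH] U UP dimU.
  exists U => u; split; first exact: UP.
  move=> _; suff -> : U = {:V}%VS by rewrite memvf.
  by apply/eqP; rewrite eqEdim subvf /= -subn_eq0 -leqn0.
have [all|/not_all_ex_not [u]] := classic (forall u, P u -> u \in U).
  by exists U => u; split; [exact: UP | exact: all].
move/(imply_to_and (P u)) => [Pu /negP uU].
apply: (IH (U + <[u]>)%VS) => [w|].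
  by case/memv_addP => a aU [b /vlineP[c ->] ->]; rewrite addrC;
    apply: Plin (UP _ aU).
suff : (\dim U < \dim (U + <[u]>))%N by lia.
rewrite ltn_neqAle dimvS ?addvSl // andbT; apply: contra uU => dimE.
have /eqP -> : U == (U + <[u]>)%VS by rewrite eqEdim addvSl (eqP dimE) leqnn.
by rewrite -{1}[u]add0r memv_add ?mem0v ?memv_line.
Qed.

(** Passage to coordinates with respect to a basis of V. The vectors whose orbit
    is annihilated by phi form a submodule; if it contains v then it is all of
    V, and phi is zero. *)
Lemma irreducible_weights_leq_dim (F : closedFieldType) r (V : vectType F)
    (rho : 'M[F]_r.+1 -> 'End(V)) (lambda : dominant_weight r)
    (nus : seq {ffun 'I_r.+1 -> nat}) :
  is_rational_repr rho -> is_irreducible rho -> has_highest_weight rho lambda ->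
  uniq nus -> (forall nu, nu \in nus -> torus_weight F lambda nu) ->
  (size nus <= \dim {:V})%N.
Proof.
move=> [[rho1 rhoM] rho_reg] [_ irr] [v [v_n0 v_up v_tor]].
set m := \dim {:V}; pose e := vbasis {:V}.
pose R A : 'M[F]_m := \matrix_(i, j) coord e i (rho A e`_j).
pose cv (u : V) : 'cV[F]_m := \col_i coord e i u.
have cvE u : u = \sum_i cv u i 0 *: e`_i.
  rewrite {1}(coord_vbasis (memvf u)).
  by apply: eq_bigr => i _; rewrite mxE.
have Rcv A u : R A *m cv u = cv (rho A u).
  apply/colP => i; rewrite !mxE [in RHS](cvE u) !linear_sum.
  by apply: eq_bigr => j _; rewrite !linearZ /= !mxE mulrC.
have coord_e (i j : 'I_m) : coord e i e`_j = (i == j)%:R.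
  by rewrite coord_free 1?eq_sym //; apply: basis_free (vbasisP _).
have cv_e (j : 'I_m) : cv e`_j = delta_mx j 0.
  by apply/colP => i; rewrite !mxE coord_e andbT.
have cv_inj u : cv u = 0 -> u = 0.
  by move=> u0; rewrite (cvE u) big1 // => i _; rewrite u0 mxE scale0r.
have mx_eq (A B : 'M[F]_m) : (forall u, A *m cv u = B *m cv u) -> A = B.
  by move=> AB; apply/matrixP => i j; have := AB e`_j;
    rewrite cv_e -!colE => /colP/(_ i); rewrite !mxE.
apply: (@weights_leq_dim _ _ _ R lambda (cv v)) => //.
- by apply: mx_eq => u; rewrite Rcv rho1 id_lfunE mul1mx.
- move=> A B A1 B1; apply: mx_eq => u.
  by rewrite -mulmxA !Rcv rhoM // comp_lfunE.
- move=> i j; have := rho_reg (linfun (coord e i : V -> F^o)) e`_j.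
  by apply: regular_eq => A; rewrite lfunE mxE.
- by apply: contra_neq v_n0 => /cv_inj.
- by move=> u hu; rewrite Rcv v_up.
- by move=> t t1; rewrite Rcv v_tor //; apply/colP => i; rewrite !mxE linearZ.
move=> phi phi0.
have cvD a u w : cv (a *: u + w) = a *: cv u + cv w.
  by apply/colP => i; rewrite !mxE linearP.
have [|a u w Pu Pw|U UP] := definable_subspace
    (P := fun u => forall g, g \in SL r.+1 F -> phi *m cv (rho g u) = 0).
- move=> g _; rewrite linear0; have -> : cv 0 = 0; last by rewrite mulmx0.
  by apply/colP => i; rewrite !mxE linear0.
- by move=> g gSL; rewrite linearP cvD mulmxDr -scalemxAr Pu // Pw // scaler0
    addr0.
have [|U0|Ufull] := irr U.
- move=> A ASL; apply/subvP => _ /memv_imgP[u uU ->]; apply/UP => g gSL.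
  have := (UP u).1 uU (g *m A) (SL_mul gSL ASL).
  by rewrite rhoM // comp_lfunE.
- have : v \in U by apply/UP => g gSL; rewrite -Rcv mulmxA phi0.
  by rewrite U0 memv0 (negPf v_n0).
apply/rowP => j; have : e`_j \in U by rewrite Ufull memvf.
move/UP/(_ _ (SL1 _ _)); rewrite rho1 id_lfunE cv_e -colE.
by move/matrixP/(_ 0 0); rewrite !mxE.
Qed.

(** * Weights of the minor product *)

Lemma torus_weight_eq (F : fieldType) r (lambda : dominant_weight r)
    (nu nu' : 'I_r.+1 -> nat) :
  nu =1 nu' -> torus_weight F lambda nu -> torus_weight F lambda nu'.
Proof.
move=> E nu_wt e; have [x [g [xSL gSL]]] := nu_wt e.
by under eq_bigr do rewrite E; exists x, g.
Qed.

Lemma perm_diag_mx (R : comNzRingType) n (s : 'S_n) (d : 'rV[R]_n) :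
  perm_mx s *m diag_mx d *m perm_mx s^-1 = diag_mx (\row_i d 0 (s i)).
Proof.
rewrite -row_permE -[s in perm_mx s^-1]invgK.
apply/matrixP => i j.
by rewrite -col_permE !mxE invgK (inj_eq perm_inj).
Qed.

(** The Weyl group acts by signed permutation matrices. *)
Lemma torus_weight_perm (F : fieldType) r (lambda : dominant_weight r)
    (nu : 'I_r.+1 -> nat) (s : 'S_r.+1) :
  torus_weight F lambda nu -> torus_weight F lambda (nu \o s).
Proof.
move=> nu_wt e; have [x [g [xSL gSL T]]] := nu_wt (e \o (s^-1)%g).
pose eps : F := (-1) ^+ s.
have eps2 : eps * eps = 1 by rewrite -expr2 sqrr_sign.
pose S := first_row_scaling r eps.
have SS (K : comNzRingType) (a : K) : a * a = 1 ->
    first_row_scaling r a *m first_row_scaling r a = 1%:M.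
  move=> a2; rewrite mulmx_diag; apply/matrixP => i j; rewrite !mxE.
  by case: eqP => _; rewrite ?a2 ?mulr1.
exists (x *m (perm_mx s^-1 *m S)), (S *m perm_mx s *m g).
rewrite !inE !det_mulmx !det_perm odd_permV det_first_row_scaling.
move: xSL gSL; rewrite !inE => /eqP-> /eqP->.
rewrite mulr1 mul1r -/eps eps2 !eqxx; split=> //.
rewrite (reindex_perm s^-1)%g /=.
under eq_bigr do rewrite permKV.
set M := (X in minor_product _ X).
suff -> : M = map_mx polyC x *m torus_num F (e \o (s^-1)%g) *m map_mx polyC g.
  exact: T.
rewrite /M !map_mxM !map_perm_mx -!mulmxA; congr (_ *m _).
rewrite !mulmxA; congr (_ *m _).
have -> : map_mx polyC S = first_row_scaling r (eps%:P).
  by apply/matrixP => i j; rewrite !mxE rmorphMn /=; case: eqP.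
rewrite -[perm_mx _ *m _ *m _]mulmxA.
have -> : first_row_scaling r eps%:P *m torus_num F e =
    torus_num F e *m first_row_scaling r eps%:P.
  exact: diag_mxC.
rewrite -!mulmxA [first_row_scaling _ _ *m (first_row_scaling _ _ *m _)]mulmxA.
rewrite SS -?polyCM ?eps2 // mul1mx mulmxA.
rewrite -[s in X in _ *m perm_mx X]invgK perm_diag_mx.
by congr diag_mx; apply/rowP => i; rewrite !mxE.
Qed.

(** The hypothesis is a polynomial identity in a, and its coefficient of degree
    one is the conclusion multiplied by b. *)
Lemma polarization (F : closedFieldType) (W l t : {poly F}) b k :
  b%:R != 0 :> F ->
  (forall a : F, (W * (l + a *: t) ^+ b)`_k = 0) ->
  (W * l ^+ b.-1 * t)`_k = 0.
Proof.
case: b => [|b bn0 vanish]; first by rewrite eqxx.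
pose h := \poly_(i < b.+2) ((W * (l ^+ (b.+1 - i) * t ^+ i *+ 'C(b.+1, i)))`_k).
have h0 : h = 0.
  apply: poly_zero_closed => a; rewrite -[RHS](vanish a) exprDn mulr_sumr.
  rewrite coef_sum horner_poly; apply: eq_bigr => i _.
  rewrite exprZn -scalerAr scalerMnr -scalerAr coefZ mulrC; congr (_ * _).
have := congr1 (fun p : {poly F} => p`_1) h0.
rewrite coef_poly coef0 /= subn1 expr1 bin1 mulrnAr coefMn -mulr_natl mulrA.
by move/eqP; rewrite mulf_eq0 (negPf bn0) => /eqP.
Qed.

Definition upper_ones (R : nzRingType) n : 'M[R]_n :=
  \matrix_(i, j) (i <= j)%:R.

Lemma det_upper_ones (R : comNzRingType) n : \det (upper_ones R n) = 1.
Proof.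
rewrite -det_tr det_trig.
  by apply: big1 => i _; rewrite !mxE leqnn.
by apply/is_trig_mxP => i j ij; rewrite !mxE leqNgt ij.
Qed.

(** The rows of the all-ones upper triangular matrix span the flag of
    <1>, <1, e_1>, <1, e_1, e_2>, ..., whose nonzero Pluecker coordinates are
    those of the sets {1, .., k-1, i}. So each leading minor is a monomial times
    a linear form in the t_i, and the coefficients of that form are free. *)
Lemma lead_minor_star (R : comNzRingType) n (t : 'rV[R]_n) (G : 'M[R]_n)
    (j : 'I_n) :
  (forall a b : 'I_n, (a <= b)%N -> G a b = (a == b)%:R) ->
  lead_minor j.+1 (upper_ones R n *m diag_mx t *m G) =
    (\prod_(i < n | (i < j)%N) t 0 i) * \sum_(i < n | (j <= i)%N) t 0 i * G i j.
Proof.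
move=> hG; pose w : 'I_j.+1 -> 'I_n := widen_ord (ltn_ord j).
pose w' : 'I_j -> 'I_n := widen_ord (ltnW (ltn_ord j)).
pose N : 'M[R]_j.+1 := \matrix_(a, b)
  if (a < j)%N then t 0 (w a) * G (w a) (w b)
  else \sum_(i < n | (j <= i)%N) t 0 i * G i (w b).
have E : \matrix_(a < j.+1, b < j.+1)
    nat_entry (upper_ones R n *m diag_mx t *m G) a b = upper_ones R j.+1 *m N.
  apply/matrixP => a b; rewrite !mxE.
  rewrite -[nat_of_ord a]/(nat_of_ord (w a)) -[nat_of_ord b]/(nat_of_ord (w b)).
  rewrite nat_entryE mxE big_ord_recr /= !mxE ltnn -ltnS ltn_ord mul1r.
  rewrite (bigID (fun i : 'I_n => i < j)%N) /=; congr (_ + _).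
    rewrite (big_ord_narrow (ltnW (ltn_ord j))) /=; apply: eq_bigr => c _.
    rewrite mul_mx_diag !mxE /= ltn_ord -mulrA; congr (_ * (_ * _)).
      by congr (t 0 _); apply: val_inj.
    by congr (G _ _); apply: val_inj.
  apply: eq_big => [i|i ji]; first by rewrite -leqNgt.
  rewrite mul_mx_diag !mxE /= (leq_trans _ (_ : (j <= i)%N)) ?mul1r //.
    by rewrite -ltnS.
  by rewrite leqNgt.
rewrite /lead_minor E det_mulmx det_upper_ones mul1r det_trig; last first.
  apply/is_trig_mxP => a b ab; rewrite mxE.
  have aj : (a < j)%N by rewrite (leq_trans ab) // -ltnS.
  rewrite aj hG /= ?(ltnW ab) // -val_eqE /= ltn_eqF ?mulr0 //.
rewrite big_ord_recr /= !mxE ltnn; congr (_ * _).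
  rewrite (big_ord_narrow (ltnW (ltn_ord j))) /=; apply: eq_bigr => c _.
  rewrite mxE /= ltn_ord hG ?leqnn // eqxx mulr1.
  by congr (t 0 _); apply: val_inj.
by apply: eq_bigr => i _; congr (_ * G _ _); apply: val_inj.
Qed.

Definition star_mx (F : fieldType) n (h : 'I_n -> 'I_n -> F) : 'M[F]_n :=
  \matrix_(i, j) if (j < i)%N then h i j else (i == j)%:R.

Lemma star_mx_SL (F : fieldType) n (h : 'I_n -> 'I_n -> F) :
  star_mx h \in SL n F.
Proof.
rewrite inE det_lower_unitriangular // => i j ji.
by rewrite !mxE ltnNge ji /= eq_sym.
Qed.

Definition position r (j : 'I_r) : 'I_r.+1 := widen_ord (leqnSn r) j.

(** The partition with lambda j columns of length j + 1. *)
Definition weight_part r (lambda : dominant_weight r) (i : nat) : nat :=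
  \sum_(j < r | (i <= j)%N) lambda j.

(** Each pair (j, i) moves one unit of the partition from j to i. *)
Definition moved r (lambda : dominant_weight r) (mv : seq ('I_r * 'I_r.+1))
    (i : 'I_r.+1) : nat :=
  weight_part lambda i - count (fun p => position p.1 == i) mv
  + count (fun p => p.2 == i) mv.

Definition valid_moves r (lambda : dominant_weight r)
    (mv : seq ('I_r * 'I_r.+1)) : Prop :=
  all (fun p : 'I_r * 'I_r.+1 => p.1 < p.2)%N mv /\
  forall j, (count (fun p => p.1 == j) mv <= lambda j)%N.

Lemma sum_count_mul (I : finType) (T : Type) (f : T -> I) (e : I -> nat) s :
  (\sum_i count (fun p => f p == i) s * e i = \sum_(p <- s) e (f p))%N.
Proof.
elim: s => [|p s IH]; first by rewrite big_nil big1.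
rewrite big_cons -IH (bigD1 (f p)) //= eqxx mulnDl mul1n -addnA; congr addn.
rewrite [in RHS](bigD1 (f p)) //=; congr addn.
by apply: eq_bigr => i ip; rewrite eq_sym (negPf ip).
Qed.

Lemma weight_part_moved r (lambda : dominant_weight r) mv (e : 'I_r.+1 -> nat) :
  valid_moves lambda mv ->
  (\sum_i moved lambda mv i * e i =
   \sum_(j < r) (lambda j * (\sum_(i < r.+1 | (i < j)%N) e i)
                 + (lambda j - count (fun p => p.1 == j) mv) * e (position j))
   + \sum_(p <- mv) e p.2)%N.
Proof.
move=> [_ cnt]; rewrite -sum_count_mul.
rewrite /moved; under eq_bigr do rewrite mulnDl; rewrite big_split /=;
  congr addn.
pose c (i : 'I_r.+1) := count (fun p : 'I_r * 'I_r.+1 => position p.1 == i) mv.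
have partE (i : 'I_r.+1) :
    (weight_part lambda i - c i = \sum_(j < r | (i < j)%N) lambda j
     + \sum_(j < r | position j == i) (lambda j - count (fun p => p.1 == j)
       mv))%N.
  rewrite /weight_part (bigID (fun j : 'I_r => i < j)%N) /=.
  have -> : (\sum_(j < r | (i <= j) && (i < j)) lambda j =
             \sum_(j < r | i < j) lambda j)%N.
    by apply: eq_bigl => j; case: ltnP => [/ltnW->|]; rewrite ?andbF.
  have eq_pos (j : 'I_r) : (i <= j)%N && ~~ (i < j)%N = (position j == i).
    by rewrite -leqNgt andbC -eqn_leq.
  rewrite (eq_bigl _ _ eq_pos) -addnBA; last first.
    rewrite /c; case: (ltnP i r) => ir; last first.
      have -> // : count (fun p : 'I_r * 'I_r.+1 => position p.1 == i) mv = 0%N.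
      apply/eqP; rewrite -leqn0 leqNgt -has_count; apply/hasPn => p _.
      by rewrite -val_eqE /= neq_ltn (leq_trans (ltn_ord p.1) ir).
    rewrite (bigD1 (Ordinal ir)) -?val_eqE //=.
    apply: leq_trans (leq_addr _ _); apply: leq_trans (cnt (Ordinal ir)).
    by apply: sub_count => p; rewrite -!val_eqE.
  congr addn; rewrite /c; case: (ltnP i r) => ir.
    have pos_i j : (position j == i) = (j == Ordinal ir) by rewrite -!val_eqE.
    rewrite (eq_bigl _ _ pos_i) [in RHS](eq_bigl _ _ pos_i) !big_pred1_eq.
    by congr subn; apply: eq_count => p; rewrite /= pos_i.
  by rewrite !big_pred0 // => j; apply/negbTE; rewrite -val_eqE /= neq_ltn
    (leq_trans (ltn_ord j) ir).
under eq_bigr => i _ do rewrite -/(c i) partE mulnDl !big_distrl /=.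
rewrite big_split [in RHS]big_split /=; congr addn.
  rewrite (exchange_big_dep predT) //=.
  by apply: eq_bigr => j _; rewrite big_distrr.
rewrite (exchange_big_dep predT) //=.
apply: eq_bigr => j _; rewrite (eq_bigl (pred1 (position j))) => [|i /=].
  by rewrite big_pred1_eq.
by rewrite eq_sym.
Qed.

Section Star.

Variables (F : closedFieldType) (r : nat) (lambda : dominant_weight r).
Hypothesis lambda_unit :
  forall j b, (0 < b <= lambda j)%N -> b%:R != 0 :> F.

Variables (e : 'I_r.+1 -> nat) (k : nat).

Let T (i : 'I_r.+1) : {poly F} := 'X^(e i).
Let l (h : 'I_r.+1 -> 'I_r.+1 -> F) (j : 'I_r) : {poly F} :=
  T (position j) + \sum_(i < r.+1 | (j < i)%N) h i (position j) *: T i.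
Let base (j : 'I_r) := \prod_(i < r.+1 | (i < j)%N) T i.

Lemma minor_product_star h :
  minor_product lambda (map_mx polyC (upper_ones F r.+1) *m torus_num F e
    *m map_mx polyC (star_mx h)) = \prod_(j < r) (base j * l h j) ^+ lambda j.
Proof.
apply: eq_bigr => j _; congr (_ ^+ _).
have -> : map_mx polyC (upper_ones F r.+1) = upper_ones {poly F} r.+1.
  by apply/matrixP => a b; rewrite !mxE; case: leqP.
rewrite -[j.+1]/((position j).+1) lead_minor_star.
  congr (_ * _); first by apply: eq_bigr => i _; rewrite mxE.
  rewrite (bigD1 (position j)) //= !mxE ltnn eqxx mulr1; congr (_ + _).
  apply: eq_big => [i|i ij].
    by rewrite ltn_neqAle andbC -val_eqE /= eq_sym.
  have ji : (j < i)%N by rewrite ltn_neqAle andbC eq_sym.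
  by rewrite !mxE /= ji mulrC mul_polyC.
move=> a b ab; rewrite !mxE ltnNge ab /=.
by case: eqP.
Qed.

(** Each move is one step of polarization, in the direction of one free entry:
    it trades a factor l h j for the variable at the target of the move. *)
Lemma star_vanishing mv :
  (forall h, (minor_product lambda (map_mx polyC (upper_ones F r.+1)
    *m torus_num F e *m map_mx polyC (star_mx h)))`_k = 0) ->
  valid_moves lambda mv ->
  forall h, (\prod_(j < r) (base j ^+ lambda j
      * l h j ^+ (lambda j - count (fun p => p.1 == j) mv))
    * \prod_(p <- mv) T p.2)`_k = 0.
Proof.
move=> vanish; elim: mv => [|[j0 i0] mv IH] [mv_lt mv_cnt] h.
  rewrite big_nil mulr1 -[RHS](vanish h) minor_product_star.
  by under eq_bigr do rewrite /= subn0 -exprMn.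
move: mv_lt => /= /andP[ji mv_lt].
have mv_cnt' j : (count (fun p => p.1 == j) mv <= lambda j)%N.
  by apply: leq_trans (mv_cnt j); rewrite leq_addl.
pose b := (lambda j0 - count (fun p => p.1 == j0) mv)%N.
have b0 : (0 < b <= lambda j0)%N.
  by have := mv_cnt j0; rewrite /b /= eqxx; lia.
pose P (g : 'I_r -> nat) h := \prod_(j < r | j != j0) (base j ^+ lambda j * l h
  j ^+ g j).
pose W := base j0 ^+ lambda j0 * P (fun j => (lambda j - count (fun p => p.1 ==
  j) mv)%N) h
  * \prod_(p <- mv) T p.2.
have Wa (a : F) : (W * (l h j0 + a *: T i0) ^+ b)`_k = 0.
  pose h' i j := h i j + (if (i == i0) && (j == position j0) then a else 0).
  have l0 : l h' j0 = l h j0 + a *: T i0.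
    rewrite /l -addrA; congr (_ + _).
    rewrite (bigD1 i0) //= [in RHS](bigD1 i0) //= /h' !eqxx scalerDl -!addrA.
    congr (_ + _); rewrite addrC; congr (_ + _).
    by apply: eq_bigr => i /andP[_ /negPf ->]; rewrite addr0.
  have lj j : j != j0 -> l h' j = l h j.
    move=> jj; congr (_ + _); apply: eq_bigr => i _.
    by rewrite /h' -[position j == _]val_eqE /= val_eqE (negPf jj) andbF addr0.
  rewrite -[RHS](IH (conj mv_lt mv_cnt') h') (bigD1 j0) //= l0 -/b.
  have -> : \prod_(j < r | j != j0) (base j ^+ lambda j *
      l h' j ^+ (lambda j - count (fun p => p.1 == j) mv)) =
      P (fun j => lambda j - count (fun p => p.1 == j) mv)%N h.
    by apply: eq_bigr => j /lj ->.
  by apply: (congr1 (fun p : {poly F} => p`_k)); rewrite /W; ring.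
have Wk := polarization (lambda_unit b0) Wa.
rewrite (bigD1 j0) //= eqxx big_cons /= -[RHS]Wk.
apply: (congr1 (fun p : {poly F} => p`_k)).
have -> : (lambda j0 - (1 + count (fun p => p.1 == j0) mv) = b.-1)%N.
  by rewrite /b; lia.
have -> : \prod_(j < r | j != j0) (base j ^+ lambda j *
     l h j ^+ (lambda j - ((j0 == j) + count (fun p => p.1 == j) mv))) =
     P (fun j => lambda j - count (fun p => p.1 == j) mv)%N h.
  by apply: eq_bigr => j jj; rewrite eq_sym (negPf jj).
by rewrite /W; ring.
Qed.

End Star.

(** For restricted lambda, moving at most lambda j units away from each position
    j gives a weight: otherwise polarization in the free entries of the star
    matrix would kill the coefficient of a monomial in that monomial itself. *)
Lemma moved_torus_weight (F : closedFieldType) r (lambda : dominant_weight r)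
  mv :
  (forall j b, (0 < b <= lambda j)%N -> b%:R != 0 :> F) ->
  valid_moves lambda mv -> torus_weight F lambda (moved lambda mv).
Proof.
move=> unit_b mv_ok e; set k := (\sum_i _)%N.
have [[h hk]|none] := classic (exists h, (minor_product lambda
    (map_mx polyC (upper_ones F r.+1) *m torus_num F e
       *m map_mx polyC (star_mx h)))`_k != 0).
  exists (upper_ones F r.+1), (star_mx h); split=> //; last exact: star_mx_SL.
  by rewrite inE det_upper_ones.
have vanish h : (minor_product lambda (map_mx polyC (upper_ones F r.+1)
    *m torus_num F e *m map_mx polyC (star_mx h)))`_k = 0.
  by apply/eqP/negPn/negP => hk; apply: none; exists h.
have := star_vanishing unit_b vanish mv_ok (fun _ _ => 0); cbv beta zeta.
have lE (j : 'I_r) : \sum_(i < r.+1 | (j < i)%N) (0 : F) *: ('X^(e i) : {poly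
  F}) = 0.
  by rewrite big1 // => i _; rewrite scale0r.
rewrite (eq_bigr (fun j => 'X^(lambda j * (\sum_(i < r.+1 | (i < j)%N) e i)
    + (lambda j - count (fun p => p.1 == j) mv) * e (position j))%N));
      last first.
  by move=> j _; rewrite lE addr0 prodrXr -!exprM -exprD mulnC [X in (_ +
    X)%N]mulnC.
rewrite !prodrXr -exprD coefXn /k (weight_part_moved _ mv_ok).
by rewrite eqxx => /eqP; rewrite oner_eq0.
Qed.

(** For twice the second fundamental weight no move leaves the first position,
    so the star matrices do not reach (1,1,1,1). Here x = 1 + E_02 + E_13 and
    g = 1 + y E_20 + z E_31 make the second leading minor equal to
    (t_0 + y t_2) (t_1 + z t_3). *)
Lemma double_second_weight (F : closedFieldType) r (lambda : dominant_weight r)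
  :
  (4 <= r)%N -> 2%:R != 0 :> F ->
  (forall j : 'I_r, lambda j = if j == 1%N :> nat then 2%N else 0%N) ->
  torus_weight F lambda (fun i => (i < 4)%N : nat).
Proof.
move=> r4 two_n0 lambdaE e.
have ltr a : (a < 4)%N -> (a < r.+1)%N by lia.
pose p0 := Ordinal (ltr 0 isT); pose p1 := Ordinal (ltr 1 isT).
pose p2 := Ordinal (ltr 2 isT); pose p3 := Ordinal (ltr 3 isT).
set k := (\sum_i _)%N.
have kE : k = (e p0 + e p1 + e p2 + e p3)%N.
  rewrite /k (bigD1 p0) // (bigD1 p1) // (bigD1 p2) // (bigD1 p3) //= big1.
    by lia.
  move=> i; rewrite -!val_eqE /= => Hi.
  by have -> : (i < 4)%N = false by lia.
pose h (y z : F) (i j : 'I_r.+1) :=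
  if (i == p2) && (j == p0) then y else if (i == p3) && (j == p1) then z else 0.
pose x : 'M[F]_r.+1 := (star_mx (h 1 1))^T.
pose T (i : 'I_r.+1) : {poly F} := 'X^(e i).
pose A y z := map_mx polyC x *m torus_num F e *m map_mx polyC (star_mx (h y z)).
have entry y z (a b : 'I_r.+1) : A y z a b = \sum_i (star_mx (h 1 1) i a)%:P *
  T i * (star_mx (h y z) i b)%:P.
  by rewrite mxE; apply: eq_bigr => i _; rewrite mul_mx_diag !mxE.
have col0 y z i : star_mx (h y z) i p0 =
    if i == 0%N :> nat then 1 else if i == 2%N :> nat then y else 0.
  by rewrite mxE /h -!val_eqE /=; case: (nat_of_ord i) => [|[|[|[|?]]]].
have col1 y z i : star_mx (h y z) i p1 =
    if i == 1%N :> nat then 1 else if i == 3%N :> nat then z else 0.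
  by rewrite mxE /h -!val_eqE /=; case: (nat_of_ord i) => [|[|[|[|?]]]].
have sum4 (f : 'I_r.+1 -> {poly F}) : (forall i : 'I_r.+1, (4 <= i)%N -> f i =
  0) ->
    \sum_i f i = f p0 + f p1 + f p2 + f p3.
  move=> f0; rewrite (bigD1 p0) // (bigD1 p1) // (bigD1 p2) // (bigD1 p3) //=
    big1.
    by rewrite addr0 !addrA.
  by move=> i; rewrite -!val_eqE /= => Hi; apply: f0; lia.
have minorE y z : minor_product lambda (A y z) =
    ((T p1 + z *: T p3) ^+ 2) * (T p0 + y *: T p2) ^+ 2.
  have r1 : (1 < r)%N by lia.
  rewrite /minor_product (bigD1 (Ordinal r1)) //= big1 => [|j j1]; last first.
    by rewrite lambdaE; move: j1; rewrite -val_eqE /= => /negPf ->.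
  rewrite lambdaE /= mulr1 -exprMn; congr (_ ^+ _).
  have -> : lead_minor 2 (A y z) = A y z p0 p0 * A y z p1 p1.
    rewrite /lead_minor det_trig.
      rewrite big_ord_recr big_ord1 /= [X in X * _ = _]mxE [X in _ * X = _]mxE.
      by rewrite -(nat_entryE _ p0 p0) -(nat_entryE _ p1 p1).
    apply/is_trig_mxP => -[[|[|]] //= ?] [[|[|]] //= ?] _; rewrite mxE /=.
    rewrite -[0%N]/(nat_of_ord p0) -[1%N]/(nat_of_ord p1) nat_entryE entry.
    rewrite sum4 => [|i i4]; rewrite ?col0 ?col1 /=.
      by rewrite !mulr0 !mul0r !addr0.
    by case: (nat_of_ord i) i4 => [|[|[|[|?]]]] //= _; rewrite mulr0.
  have -> : A y z p0 p0 = T p0 + y *: T p2.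
    rewrite entry sum4 => [|i i4]; rewrite !col0 /=.
      by rewrite -!mul_polyC !polyC0 !polyC1; ring.
    by case: (nat_of_ord i) i4 => [|[|[|[|?]]]] //= _; rewrite mulr0.
  have -> : A y z p1 p1 = T p1 + z *: T p3.
    rewrite entry sum4 => [|i i4]; rewrite !col1 /=.
      by rewrite -!mul_polyC !polyC0 !polyC1; ring.
    by case: (nat_of_ord i) i4 => [|[|[|[|?]]]] //= _; rewrite mulr0.
  by rewrite mulrC.
have [[y [z hk]]|none] := classic (exists y z, (minor_product lambda (A y
  z))`_k != 0).
  exists x, (star_mx (h y z)); split=> //; last exact: star_mx_SL.
  by rewrite inE det_tr; have := star_mx_SL (h 1 1); rewrite inE.
have vanish z y : ((T p1 + z *: T p3) ^+ 2 * (T p0 + y *: T p2) ^+ 2)`_k = 0.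
  by rewrite -minorE; apply/eqP/negPn/negP => hk; apply: none; exists y, z.
have vanish' z : (T p0 * T p2 * (T p1 + z *: T p3) ^+ 2)`_k = 0.
  rewrite -[RHS](polarization two_n0 (vanish z)) expr1.
  by apply: (congr1 (fun p : {poly F} => p`_k)); ring.
have := polarization two_n0 vanish'.
rewrite expr1 /T -!exprD coefXn kE.
have -> : (e p0 + e p1 + e p2 + e p3 == e p0 + e p2 + e p1 + e p3)%N by lia.
by move/eqP; rewrite oner_eq0.
Qed.

(** * Counting weights by their level sets *)

Lemma same_counts_perm n (C : finType) (f g : 'I_n -> C) :
  (forall c, #|[set i | f i == c]| = #|[set i | g i == c]|) ->
  exists s : 'S_n, forall i, f i = g (s i).
Proof.
move=> fg; have countE (h : 'I_n -> C) c :
    count_mem c [tuple h i | i < n] = #|[set i | h i == c]|.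
  rewrite /= count_map -sum1_count big_enum_cond /= sum1dep_card.
  by apply: eq_card => i; rewrite !inE.
have /tuple_permP [s sE] : perm_eq [tuple f i | i < n] [tuple g i | i < n].
  by apply/allP => c _; rewrite /= !countE fg.
exists s => i; have := congr1 (fun t => nth (f i) t i) sE.
by rewrite -!tnth_nth !tnth_mktuple.
Qed.

Lemma card_disjoint_pairs n i j :
  #|[set K : {set 'I_n} * {set 'I_n} |
      [&& #|K.1| == i, K.2 \subset ~: K.1 & #|K.2| == j]]| =
  ('C(n, i) * 'C(n - i, j))%N.
Proof.
rewrite -sum1dep_card.
rewrite -(pair_big_dep (fun A : {set 'I_n} => #|A| == i)
   (fun A (B : {set 'I_n}) => (B \subset ~: A) && (#|B| == j)) (fun _ _ =>
     1%N)) /=.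
rewrite (eq_bigr (fun=> 'C(n - i, j))) => [|A /eqP Ai].
  have -> : 'C(n, i) = #|[set A : {set 'I_n} | #|A| == i]|.
    by rewrite card_draws card_ord.
  rewrite sum_nat_const; congr (_ * _)%N.
  by apply: eq_card => A; rewrite !inE.
by rewrite sum1dep_card cards_draws cardsCs setCK card_ord Ai.
Qed.

Lemma bin_mul_bin n m k : (k <= m)%N -> (m <= n)%N ->
  ('C(n, k) * 'C(n - k, m - k) = 'C(n, m) * 'C(m, k))%N.
Proof.
move=> km mn.
have fk : (0 < k`! * (m - k)`! * (n - m)`!)%N by rewrite !muln_gt0 !fact_gt0.
apply/eqP; rewrite -(eqn_pmul2r fk); apply/eqP.
have E1 := bin_fact (leq_trans km mn).
have E2 := bin_fact (leq_sub2r k mn).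
rewrite (_ : n - k - (m - k) = n - m)%N in E2; last by lia.
have E3 := bin_fact mn; have E4 := bin_fact km.
transitivity n`!.
  by rewrite -E1 -E2; ring.
by rewrite -E3 -E4; ring.
Qed.

Section Counting.

Variables (n d : nat) (wt : ('I_n -> nat) -> Prop).
Hypothesis wt_perm : forall nu (s : 'S_n), wt nu -> wt (nu \o s).
Hypothesis wt_count : forall nus : seq {ffun 'I_n -> nat},
  uniq nus -> (forall nu : {ffun 'I_n -> nat}, nu \in nus -> wt nu) ->
  (size nus <= d)%N.
Hypothesis wt_eq : forall nu nu', nu =1 nu' -> wt nu -> wt nu'.

(** Weights are told apart by their level sets. *)
Lemma level_sets_count (S : {set {set 'I_n} * {set 'I_n}}) (P1 P2 : pred nat) :
  (forall K, K \in S -> exists2 nu, wt nu &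
     K = ([set i | P1 (nu i)], [set i | P2 (nu i)])) ->
  (#|S| <= d)%N.
Proof.
move=> ex.
have /fin_all_exists [f fP] (K : {set 'I_n} * {set 'I_n}) :
    exists nu : {ffun 'I_n -> nat}, K \in S ->
      wt nu /\ K = ([set i | P1 (nu i)], [set i | P2 (nu i)]).
  have [KS|_] := boolP (K \in S); last by exists [ffun=> 0%N].
  have [nu nu_wt ->] := ex K KS; exists [ffun i => nu i] => _; split.
    by apply: wt_eq nu_wt => i; rewrite ffunE.
  by congr (_, _); apply/setP => i; rewrite !inE ffunE.
rewrite cardE -(size_map f); apply: wt_count.
  rewrite map_inj_in_uniq ?enum_uniq // => K K'; rewrite !mem_enum => KS KS' E.
  by have [_ ->] := fP _ KS; have [_ ->] := fP _ KS'; rewrite E.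
by move=> nu /mapP[K]; rewrite mem_enum => KS ->; have [] := fP _ KS.
Qed.

(** The symmetric group is transitive on the colourings with given numbers of
    points of each colour. *)
Lemma level_sets_transitive (P1 P2 : pred nat) nu (A B : {set 'I_n}) :
  (forall x, P1 x -> ~~ P2 x) -> wt nu ->
  #|A| = #|[set i | P1 (nu i)]| -> #|B| = #|[set i | P2 (nu i)]| ->
  B \subset ~: A ->
  exists2 nu', wt nu' & (A, B) = ([set i | P1 (nu' i)], [set i | P2 (nu' i)]).
Proof.
move=> P12 nu_wt cA cB /subsetP BA.
have AB i : i \in A -> i \in B = false.
  by move=> iA; apply/negbTE/negP => /BA; rewrite inE iA.
pose f i : bool * bool := (i \in A, i \in B).
pose g i : bool * bool := (P1 (nu i), P2 (nu i)).
have f_out i : f i <> (true, true).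
  by rewrite /f => -[iA]; rewrite AB.
have g_out i : g i <> (true, true).
  by rewrite /g => -[/P12/negPf ->].
have fA : [set i | f i == (true, false)] = A.
  apply/setP => i; rewrite inE; have := f_out i.
  by rewrite /f; case: (i \in A); case: (i \in B).
have fB : [set i | f i == (false, true)] = B.
  apply/setP => i; rewrite inE; have := f_out i.
  by rewrite /f; case: (i \in A); case: (i \in B).
have fAB : [set i | f i == (true, true)] = set0.
  by apply/setP => i; rewrite !inE; apply/eqP.
have gA : [set i | g i == (true, false)] = [set i | P1 (nu i)].
  apply/setP => i; rewrite !inE; have := g_out i.
  by rewrite /g; case: (P1 _); case: (P2 _).
have gB : [set i | g i == (false, true)] = [set i | P2 (nu i)].
  apply/setP => i; rewrite !inE; have := g_out i.
  by rewrite /g; case: (P1 _); case: (P2 _).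
have gAB : [set i | g i == (true, true)] = set0.
  by apply/setP => i; rewrite !inE; apply/eqP.
have total (h : 'I_n -> bool * bool) :
    (#|[set i | h i == (false, false)]| + #|[set i | h i == (true, false)]|
     + #|[set i | h i == (false, true)]| + #|[set i | h i == (true, true)]| =
       n)%N.
  have cardE c : #|[set i | h i == c]| = (\sum_i (h i == c))%N.
    by rewrite -sum1dep_card big_mkcond; apply: eq_bigr => i _; case: eqP.
  rewrite !cardE -!big_split -[RHS]card_ord -sum1_card /=.
  by apply: eq_bigr => i _; case: (h i) => [[] []].
have [c|s fg] := @same_counts_perm _ _ f g.
  have := etrans (total f) (esym (total g)); rewrite fA fB fAB gA gB gAB cA cB.
  move/eqP; rewrite !eqn_add2r => /eqP ff.
  by case: c => [[] []]; rewrite ?fA ?fB ?fAB ?gA ?gB ?gAB ?cA ?cB.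
exists (nu \o s); first exact: wt_perm.
by congr (_, _); apply/setP => i; rewrite inE; case: (fg i).
Qed.

(** One Weyl orbit realizes all pairs of disjoint level sets of these sizes. *)
Lemma two_levels_count (P1 P2 : pred nat) nu :
  (forall x, P1 x -> ~~ P2 x) -> wt nu ->
  ('C(n, #|[set i | P1 (nu i)]|)
   * 'C(n - #|[set i | P1 (nu i)]|, #|[set i | P2 (nu i)]|) <= d)%N.
Proof.
move=> P12 nu_wt; rewrite -card_disjoint_pairs.
apply: (level_sets_count (P1 := P1) (P2 := P2)) => -[A B].
rewrite inE => /and3P[/= /eqP cA BA /eqP cB].
exact: (level_sets_transitive P12 nu_wt cA cB BA).
Qed.

Lemma one_level_count (P : pred nat) nu :
  wt nu -> ('C(n, #|[set i | P (nu i)]|) <= d)%N.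
Proof.
move=> nu_wt; have := two_levels_count (P1 := P) (P2 := pred0) _ nu_wt.
rewrite (_ : [set i | pred0 (nu i)] = set0) ?cards0 ?bin0 ?muln1;
  first by apply.
by apply/setP => i; rewrite !inE.
Qed.

(** One of the values splits the four entries into k and 4 - k of them with
    0 < k < 4, which gives C(n,4) C(4,k) pairs of level sets. *)
Lemma four_nonconstant_count c nu :
  (4 <= n)%N -> wt nu -> #|[set i | nu i != c]| = 4%N ->
  (exists i j, [/\ nu i != c, nu j != c & nu i != nu j]) ->
  (4 * 'C(n, 4) <= d)%N.
Proof.
move=> n4 nu_wt card4 [i [j [ic jc ij]]].
pose P1 x := x == nu i; pose P2 x := (x != c) && (x != nu i).
have P12 x : P1 x -> ~~ P2 x by move=> /eqP->; rewrite /P2 eqxx andbF.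
have := two_levels_count P12 nu_wt.
set a := #|_|; set b := #|_| => le_d; apply: leq_trans le_d.
have ab : (a + b = 4)%N.
  rewrite -card4 -cardsUI (_ : _ :|: _ = [set i | nu i != c]); last first.
    apply/setP => k; rewrite !inE /P1 /P2.
    by case: eqP => [->|]; rewrite ?ic ?andbT.
  rewrite (_ : _ :&: _ = set0) ?cards0 ?addn0 //.
  by apply/setP => k; rewrite !inE /P1 /P2; case: eqP; rewrite ?andbF.
have a0 : (0 < a)%N by apply/card_gt0P; exists i; rewrite inE /P1.
have b0 : (0 < b)%N by apply/card_gt0P; exists j; rewrite inE /P2 jc eq_sym.
have -> : b = (4 - a)%N by lia.
rewrite bin_mul_bin //; last by lia.
rewrite mulnC leq_mul2l; apply/orP; right.
by have [->|[->|->]] : (a = 1 \/ a = 2 \/ a = 3)%N by lia.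
Qed.

(** Two orbits, which the number of entries in P tells apart. *)
Lemma four_three_count (P : pred nat) nu nu' :
  wt nu -> wt nu' ->
  #|[set i | P (nu i)]| = 4%N -> #|[set i | P (nu' i)]| = 3%N ->
  ('C(n, 4) + 'C(n, 3) <= d)%N.
Proof.
move=> nu_wt nu_wt' c4 c3.
pose U k := [set K : {set 'I_n} * {set 'I_n} |
      [&& #|K.1| == k, K.2 \subset ~: K.1 & #|K.2| == 0%N]].
have UE k : #|U k| = 'C(n, k) by rewrite card_disjoint_pairs bin0 muln1.
rewrite -UE -(UE 3%N) -cardsUI (_ : U 4 :&: U 3 = set0)%N ?cards0 ?addn0;
  last first.
  by apply/setP => K; rewrite !inE; case: eqP => [->|] /=; rewrite ?andbF.
have no (mu : 'I_n -> nat) : #|[set i | pred0 (mu i)]| = 0%N.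
  by apply/eqP; rewrite cards_eq0; apply/eqP/setP => i; rewrite !inE.
apply: (level_sets_count (P1 := P) (P2 := pred0)) => -[A B].
rewrite !inE /= => /orP[] /and3P[/eqP cA BA /eqP cB].
  exact: (level_sets_transitive (P1 := P) (P2 := pred0) (fun _ _ => isT) nu_wt
    (etrans cA (esym c4)) (etrans cB (esym (no nu))) BA).
exact: (level_sets_transitive (P1 := P) (P2 := pred0) (fun _ _ => isT) nu_wt'
  (etrans cA (esym c3)) (etrans cB (esym (no nu'))) BA).
Qed.

End Counting.

(** * Binomial coefficients against the dimension bound *)

Lemma dim_bound_lt_4binom4 n : (8 <= n)%N -> (dim_bound n < 4 * 'C(n, 4))%N.
Proof.
move=> n8; rewrite /dim_bound; case: eqP => [->|_].
  by vm_compute.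
have : (0 < 'C(n, 4))%N by rewrite bin_gt0; lia.
by lia.
Qed.

Lemma dim_bound_lt_binom4_binom3 n :
  (8 <= n)%N -> (dim_bound n < 'C(n, 4) + 'C(n, 3))%N.
Proof.
move=> n8; rewrite /dim_bound; case: eqP => [->|_].
  by vm_compute.
have : (0 < 'C(n, 3))%N by rewrite bin_gt0; lia.
by lia.
Qed.

Lemma binom_unimodal n a k : (a <= k)%N -> (k + k <= n)%N -> ('C(n, a) <= 'C(n,
  k))%N.
Proof.
elim: k => [|k IH]; first by rewrite leqn0 => /eqP->.
rewrite leq_eqVlt => /orP[/eqP->//|]; rewrite ltnS => ak kn.
apply: leq_trans (IH ak _) _; first by lia.
rewrite -(leq_pmul2l (ltn0Sn k)) mul_bin_left leq_mul2r; apply/orP; right; lia.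
Qed.

(** Binomial coefficients increase up to the middle, and the ratio of C(n,5) to
    C(n,4) is (n - 4) / 5, with n >= 10. *)
Lemma dim_bound_lt_middle n k :
  (5 <= k)%N -> (k + 5 <= n)%N -> (dim_bound n < 'C(n, k))%N.
Proof.
move=> k5 kn; have n10 : (10 <= n)%N by lia.
have le5 : ('C(n, 5) <= 'C(n, k))%N.
  have [kk|kk] := leqP (k + k) n; first exact: binom_unimodal.
  by rewrite -[X in (_ <= X)%N]bin_sub; [apply: binom_unimodal; lia | lia].
apply: leq_trans le5; rewrite /dim_bound; case: eqP => [->|_].
  by vm_compute.
have := mul_bin_left n 4; have : (0 < 'C(n, 4))%N by rewrite bin_gt0; lia.
have : (6 * 'C(n, 4) <= (n - 4) * 'C(n, 4))%N by rewrite leq_mul2r; apply/orP;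
  right; lia.
by lia.
Qed.

Lemma binom4_lt_two_levels n a b : (8 <= n)%N ->
  (0 < a <= 3)%N -> (0 < b <= 3)%N -> (4 <= a + b)%N ->
  (4 * 'C(n, 4) <= 'C(n, a) * 'C(n - a, b))%N.
Proof.
move=> n8 a3 b3 ab.
have := @bin_mul_bin n (a + b) a; rewrite addKn => -> //; try lia.
have E4 := mul_bin_left n 4; have E5 := mul_bin_left n 5.
have le4 : (4 * 'C(n, 4) <= (n - 4) * 'C(n, 4))%N.
  by rewrite leq_mul2r; apply/orP; right; lia.
have le5 : (3 * 'C(n, 5) <= (n - 5) * 'C(n, 5))%N.
  by rewrite leq_mul2r; apply/orP; right; lia.
have [[-> ->]|[[-> ->]|[[-> ->]|[[-> ->]|[[-> ->]|[-> ->]]]]]] :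
  (a = 1 /\ b = 3 \/ a = 2 /\ b = 2 \/ a = 3 /\ b = 1 \/ a = 2 /\ b = 3 \/
   a = 3 /\ b = 2 \/ a = 3 /\ b = 3)%N by lia.
all: rewrite -?[(1 + 3)%N]/4%N -?[(2 + 2)%N]/4%N -?[(3 + 1)%N]/4%N
  -?[(2 + 3)%N]/5%N -?[(3 + 2)%N]/5%N -?[(3 + 3)%N]/6%N.
- by rewrite (_ : 'C(4, 1) = 4%N) //; lia.
- by rewrite (_ : 'C(4, 2) = 6%N) //; lia.
- by rewrite (_ : 'C(4, 3) = 4%N) //; lia.
- by rewrite (_ : 'C(5, 2) = 10%N) //; lia.
- by rewrite (_ : 'C(5, 3) = 10%N) //; lia.
- by rewrite (_ : 'C(6, 3) = 20%N) //; lia.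
Qed.

Lemma leq_binom m j : (0 < j)%N -> (j < m)%N -> (m <= 'C(m, j))%N.
Proof.
elim: m j => [|m IH] [|j] // _ jm.
rewrite binS; have [<-|jm'] := eqVneq j.+1 m; first by rewrite binn binSn.
have IHj : (m <= 'C(m, j.+1))%N by apply: IH; lia.
have : (0 < 'C(m, j))%N by rewrite bin_gt0; lia.
by lia.
Qed.

(** * Partitions and moves *)

Lemma card_interval n a b : (b <= n)%N ->
  #|[set i : 'I_n | (a <= i < b)%N]| = (b - a)%N.
Proof.
move=> bn; rewrite -sum1dep_card -(big_mkord (fun i => a <= i < b)%N (fun=>
  1%N)).
rewrite -(big_nat_widen 0 b n (fun i => a <= i)%N) //.
have [ab|ba] := leqP a b.
  by rewrite -(big_nat_widenl a 0 b predT) // sum_nat_const_nat muln1.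
rewrite big_nat_cond big1 ?(eqP (ltnW ba : (b - a == 0)%N)) // => i.
by case/andP=> /andP[_ ib] ai; lia.
Qed.

(** The weights met below are constant on the positions from 5 to r - 3, so
    their level sets are counted on the other positions. *)
Lemma card_ends r (p : pred nat) : (7 <= r)%N ->
  (forall x, (5 <= x < r - 2)%N -> p x = false) ->
  #|[set i : 'I_r.+1 | p i]| =
  (p 0 + p 1 + p 2 + p 3 + p 4 + p (r - 2) + p (r - 1) + p r)%N.
Proof.
move=> r7; have [k ->] : exists k, r = k.+4.+3 by exists (r - 7)%N; lia.
move=> p_mid; rewrite -sum1dep_card big_mkcond /=.
rewrite (eq_bigr (fun i : 'I_k.+4.+4 => p i : nat)) => [|i _];
  last by case: (p i).
rewrite 3!big_ord_recr 5!big_ord_recl /= big1 => [|i _].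
  rewrite (_ : k.+4.+3 - 2 = k.+4.+1)%N; last by lia.
  rewrite (_ : k.+4.+3 - 1 = k.+4.+2)%N; last by lia.
  rewrite -[bump 0 (bump 0 (bump 0 (bump 0 0)))]/4%N -[bump 0 (bump 0 (bump 0
    0))]/3%N.
  by rewrite -[bump 0 (bump 0 0)]/2%N -[bump 0 0]/1%N addn0 !addnA.
by rewrite p_mid // /bump /=; have := ltn_ord i; lia.
Qed.

(** Total in x, so that positions near both ends are plain naturals. *)
Definition coeff r (lambda : dominant_weight r) (x : nat) : nat :=
  if insub x is Some j then lambda j else 0%N.

Lemma coeffE r (lambda : dominant_weight r) (j : 'I_r) :
  coeff lambda j = lambda j.
Proof. by rewrite /coeff valK. Qed.

Lemma coeff_out r (lambda : dominant_weight r) x :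
  (r <= x)%N -> coeff lambda x = 0%N.
Proof. by move=> rx; rewrite /coeff insubF // ltnNge rx. Qed.

Lemma weight_partS r (lambda : dominant_weight r) x :
  weight_part lambda x = (coeff lambda x + weight_part lambda x.+1)%N.
Proof.
rewrite /weight_part; have [xr|rx] := ltnP x r; last first.
  rewrite coeff_out // !big1 // => j jx; exfalso.
    by have := ltn_ord j; lia.
  by have := ltn_ord j; lia.
rewrite (bigD1 (Ordinal xr)) //= -[x in coeff _ x]/(nat_of_ord (Ordinal xr)).
rewrite coeffE; congr addn; apply: eq_bigl => j.
by rewrite -val_eqE /=; lia.
Qed.

Lemma weight_part_end r (lambda : dominant_weight r) x :
  (r <= x)%N -> weight_part lambda x = 0%N.
Proof. by move=> rx; rewrite /weight_part big1 // => j; have := ltn_ord j;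
  lia. Qed.

Lemma weight_part_mono r (lambda : dominant_weight r) x y :
  (x <= y)%N -> (weight_part lambda y <= weight_part lambda x)%N.
Proof.
move=> xy; rewrite -(subnK xy); elim: (y - x)%N => [|k IH] //.
by apply: leq_trans IH; rewrite (weight_partS _ (k + x)) leq_addl.
Qed.

Lemma weight_part_const r (lambda : dominant_weight r) x y :
  (x <= y)%N -> (forall z, (x <= z < y)%N -> coeff lambda z = 0%N) ->
  weight_part lambda y = weight_part lambda x.
Proof.
move=> xy; rewrite -(subnK xy); elim: (y - x)%N => [|k IH] // z0.
have IHk : weight_part lambda (k + x) = weight_part lambda x.
  by apply: IH => z zk; apply: z0; lia.
by rewrite -IHk [in RHS]weight_partS z0 ?add0n //; lia.
Qed.

Lemma weight_part_level r (lambda : dominant_weight r) j i :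
  (0 < coeff lambda j)%N ->
  (weight_part lambda j <= weight_part lambda i)%N = (i <= j)%N.
Proof.
move=> j0; have [ij|ji] := leqP i j; first by rewrite weight_part_mono.
apply/negbTE; rewrite -ltnNge.
by have := weight_part_mono lambda ji; have := weight_partS lambda j; lia.
Qed.

Definition nat_moved r (lambda : dominant_weight r) (mv : seq (nat * nat)) x :=
  (weight_part lambda x - count (fun p => p.1 == x) mv
   + count (fun p => p.2 == x) mv)%N.

Lemma nat_moved_weight (F : closedFieldType) r (lambda : dominant_weight r) mv :
  (forall j b, (0 < b <= lambda j)%N -> b%:R != 0 :> F) ->
  all (fun p => p.1 < p.2 <= r)%N mv ->
  (forall x, count (fun p => p.1 == x) mv <= coeff lambda x)%N ->
  torus_weight F lambda (fun i => nat_moved lambda mv i).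
Proof.
move=> unit_b mv_lt mv_cnt.
have [mv' mvE] : exists mv' : seq ('I_r * 'I_r.+1),
    mv = [seq (nat_of_ord p.1, nat_of_ord p.2) | p <- mv'].
  elim: mv mv_lt {mv_cnt} => [|[a b] mv IH] /=; first by exists [::].
  case/andP=> /andP[ab br] /IH[mv' ->].
  have ar : (a < r)%N by lia.
  by exists ((Ordinal ar, Ordinal (br : b < r.+1)%N) :: mv').
rewrite mvE in mv_lt mv_cnt *.
apply: torus_weight_eq (moved_torus_weight (mv := mv') unit_b _).
  move=> i; rewrite /moved /nat_moved !count_map.
  by congr (_ - _ + _)%N; apply: eq_count => p.
split.
  by move: mv_lt; rewrite all_map; apply: sub_all => p /= /andP[].
move=> j; rewrite -coeffE; apply: leq_trans (mv_cnt j).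
by rewrite count_map; apply: sub_count => p.
Qed.

(** * Small weight sets *)

Definition listed r (lambda : dominant_weight r) : Prop :=
  let w := fundamental_weight r in
  lambda = 0
  \/ (exists a : nat, (1 <= a <= 3)%N /\
        (lambda = w 1%N *+ a \/ lambda = w r *+ a))
  \/ lambda = w 1%N + w r
  \/ (lambda = w 2%N \/ lambda = w (r - 1)%N)
  \/ (lambda = w 3%N \/ lambda = w (r - 2)%N)
  \/ (lambda = w 4%N \/ lambda = w (r - 3)%N)
  \/ (lambda = w 1%N + w 2%N \/ lambda = w (r - 1)%N + w r)
  \/ (lambda = w 1%N *+ 2 + w r \/ lambda = w 1%N + w r *+ 2)
  \/ (lambda = w 2%N + w r \/ lambda = w 1%N + w (r - 1)%N).

Lemma fundamentalE r j (i : 'I_r) : fundamental_weight r j i = (i.+1 == j)%N.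
Proof. by rewrite ffunE. Qed.

Lemma weightDE r (f g : dominant_weight r) i : (f + g) i = (f i + g i)%N.
Proof. by rewrite ffunE. Qed.

Lemma weightMnE r (f : dominant_weight r) k i : (f *+ k) i = (f i * k)%N.
Proof.
elim: k => [|k IH]; first by rewrite mulr0n ffunE muln0.
by rewrite mulrS weightDE IH mulnS.
Qed.

Definition weightE := (fundamentalE, weightDE, weightMnE).

Section Cases.

Variables (F : closedFieldType) (r d : nat) (lambda : dominant_weight r).
Hypothesis r7 : (7 <= r)%N.
Hypothesis lambda_unit :
  forall j b, (0 < b <= lambda j)%N -> b%:R != 0 :> F.
Hypothesis d_bound : (d <= dim_bound r.+1)%N.
Hypothesis weights_count : forall nus : seq {ffun 'I_r.+1 -> nat},
  uniq nus -> (forall nu : {ffun 'I_r.+1 -> nat}, nu \in nus ->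
    torus_weight F lambda nu) -> (size nus <= d)%N.

Local Open Scope nat_scope.

Let wt := torus_weight F lambda.
Let a := coeff lambda.
Let L := weight_part lambda.

Let wt_perm nu (s : 'S_r.+1) : wt nu -> wt (nu \o s).
Proof. exact: torus_weight_perm. Qed.

Let wt_eq nu nu' : nu =1 nu' -> wt nu -> wt nu'.
Proof. exact: torus_weight_eq. Qed.

Let moved_wt mv : all (fun p => p.1 < p.2 <= r)%N mv ->
  (forall x, count (fun p => p.1 == x) mv <= a x)%N ->
  wt (fun i => nat_moved lambda mv i).
Proof. exact: nat_moved_weight. Qed.

Let L_wt : wt (fun i => L i).
Proof.
apply: wt_eq (moved_wt (mv := [::]) isT (fun _ => leq0n _)) => i.
by rewrite /nat_moved /= subn0 addn0.
Qed.

Lemma four_nonconstant_false nu c :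
  wt (fun i => nu (nat_of_ord i)) ->
  (forall x, (5 <= x < r - 2)%N -> nu x = c) ->
  ((nu 0 != c) + (nu 1 != c) + (nu 2 != c) + (nu 3 != c) + (nu 4 != c)
   + (nu (r - 2) != c) + (nu (r - 1) != c) + (nu r != c))%N = 4%N ->
  (exists x y, [/\ (x <= r)%N, (y <= r)%N, nu x != c, nu y != c & nu x != nu
    y]) ->
  False.
Proof.
move=> nu_wt nu_mid c4 [x [y [xr yr xc yc xy]]].
have card4 : #|[set i : 'I_r.+1 | nu i != c]| = 4%N.
  by rewrite (card_ends (p := fun z => nu z != c)) // => z /nu_mid ->;
    rewrite eqxx.
have le4 : (4 * 'C(r.+1, 4) <= d)%N.
  have r4 : (4 <= r.+1)%N by lia.
  apply: (four_nonconstant_count wt_perm weights_count wt_eq r4 nu_wt card4).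
  by exists (Ordinal (xr : x < r.+1)%N), (Ordinal (yr : y < r.+1)%N).
have : (dim_bound r.+1 < 4 * 'C(r.+1, 4))%N by apply: dim_bound_lt_4binom4; lia.
by rewrite ltnNge (leq_trans le4 d_bound).
Qed.

Lemma four_three_false (P : pred nat) nu nu' :
  wt (fun i => nu (nat_of_ord i)) -> wt (fun i => nu' (nat_of_ord i)) ->
  #|[set i : 'I_r.+1 | P (nu i)]| = 4%N ->
  #|[set i : 'I_r.+1 | P (nu' i)]| = 3%N -> False.
Proof.
move=> nu_wt nu_wt' c4 c3.
have le := four_three_count wt_perm weights_count wt_eq nu_wt nu_wt' c4 c3.
have lt : (dim_bound r.+1 < 'C(r.+1, 4) + 'C(r.+1, 3))%N.
  by apply: dim_bound_lt_binom4_binom3; lia.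
by move: lt; rewrite ltnNge (leq_trans le d_bound).
Qed.

Lemma two_levels_false (P1 P2 : pred nat) nu i j :
  (forall x, P1 x -> ~~ P2 x) -> wt nu ->
  #|[set k : 'I_r.+1 | P1 (nu k)]| = i -> #|[set k : 'I_r.+1 | P2 (nu k)]| = j
    ->
  (4 * 'C(r.+1, 4) <= 'C(r.+1, i) * 'C(r.+1 - i, j))%N -> False.
Proof.
move=> P12 nu_wt ci cj.
have := two_levels_count wt_perm weights_count wt_eq P12 nu_wt; rewrite ci cj.
have lt : (dim_bound r.+1 < 4 * 'C(r.+1, 4))%N by apply: dim_bound_lt_4binom4;
  lia.
move=> le_d le4; move: lt.
by rewrite ltnNge (leq_trans (leq_trans le4 le_d) d_bound).
Qed.

Lemma interval_card (p : pred nat) x y : (y <= r.+1)%N ->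
  (forall i : 'I_r.+1, p i = (x <= i < y)%N) ->
  #|[set i : 'I_r.+1 | p i]| = (y - x)%N.
Proof.
move=> yr pE; rewrite -(card_interval (n := r.+1) x yr).
by apply: eq_card => i; rewrite !inE pE.
Qed.

(** The first j + 1 positions form a level set. *)
Lemma middle_coeff_false j : (4 <= j)%N -> (j + 5 <= r)%N -> (0 < a j)%N ->
  False.
Proof.
move=> j4 jr aj.
have card_j : #|[set i : 'I_r.+1 | (L j <= L i)%N]| = j.+1.
  rewrite (@interval_card (fun i => L j <= L i)%N 0 j.+1) //; first by lia.
  by move=> i; rewrite [LHS]weight_part_level.
have := one_level_count wt_perm weights_count wt_eq (leq (L j)) L_wt;
  rewrite card_j.
have : (dim_bound r.+1 < 'C(r.+1, j.+1))%N by apply: dim_bound_lt_middle; lia.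
by rewrite ltnNge => /negP lt le_d; apply: lt; apply: leq_trans d_bound.
Qed.

Lemma L_decr x : L x = (a x + L x.+1)%N.
Proof. exact: weight_partS. Qed.

(** The first four positions form a level set, and any other jump of the
    partition splits these positions or the remaining ones. Without such a jump,
    lambda is a multiple of the fourth fundamental weight, and if it is a proper
    one then moving one unit gives a second orbit. *)
Lemma fourth_coeff : (0 < a 3)%N -> listed lambda.
Proof.
move=> a3.
have level3 i : (L 3 <= L i)%N = (i <= 3)%N by apply: weight_part_level.
have card3 : #|[set i : 'I_r.+1 | (L 3 <= L i)%N]| = 4%N.
  rewrite (@interval_card (fun i => L 3 <= L i)%N 0 4) //; lia.
have high j : (3 < j)%N -> a j = 0%N.
  move=> j3; apply/eqP; rewrite -leqn0 leqNgt; apply/negP => aj.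
  have jr : (j < r)%N by rewrite ltnNge; apply/negP => rj; move: aj;
    rewrite /a coeff_out.
  have levelj i : (L j <= L i)%N = (i <= j)%N by apply: weight_part_level.
  apply: (two_levels_false (P1 := leq (L 3)) (P2 := fun x => (x < L j)%N) (j :=
    (r - j)%N) _ L_wt card3).
  - by move=> x; have := level3 j; lia.
  - rewrite (@interval_card (fun i => L i < L j)%N j.+1 r.+1) //.
    by move=> i; rewrite ltnNge levelj -ltnNge ltn_ord andbT.
  rewrite mulnC leq_mul2l; apply/orP; right.
  by apply: leq_trans (leq_binom _ _); lia.
have low j : (j < 3)%N -> a j = 0%N.
  move=> j3; apply/eqP; rewrite -leqn0 leqNgt; apply/negP => aj.
  have levelj i : (L j <= L i)%N = (i <= j)%N by apply: weight_part_level.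
  apply: (two_levels_false (P1 := leq (L j)) (P2 := fun x => (L 3 <= x < L
    j)%N) (i := j.+1) (j := (3 - j)%N) _ L_wt).
  - by move=> x; lia.
  - rewrite (@interval_card (fun i => L j <= L i)%N 0 j.+1) //; lia.
  - rewrite (@interval_card (fun i => L 3 <= L i < L j)%N j.+1 4) //;
      first by lia.
    by move=> i; rewrite level3 ltnNge levelj -ltnNge andbC.
  by apply: binom4_lt_two_levels; lia.
have [a31|a32] : a 3 = 1%N \/ (2 <= a 3)%N by lia.
  do 5 right; left; left; apply/ffunP => i; rewrite weightE -coeffE -/(a i).
  have [->|i3] := eqVneq (i : nat) 3%N; first by rewrite a31.
  have ai : a i = 0%N.
    have [i_lt|i_gt] : (i < 3 \/ 3 < i)%N by lia.
      exact: low.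
    exact: high.
  by rewrite ai; lia.
exfalso.
pose nu := nat_moved lambda [:: (3, 4)].
have nu_wt : wt (fun i => nu (nat_of_ord i)).
  apply: moved_wt => [|x] /=; first by rewrite andbT; lia.
  by rewrite addn0; case: eqP => [<-|]; lia.
have L4 x : (4 <= x)%N -> L x = 0%N.
  move=> x4; rewrite /L; have [rx|xr] := leqP r x; first exact: weight_part_end.
  by rewrite -(weight_part_end lambda (leqnn r)) [RHS](weight_part_const (x :=
    x)) //; [lia|move=> z xz; apply: high; lia].
have L3 : L 3 = a 3 by rewrite L_decr L4 ?addn0.
apply: (four_three_false L_wt nu_wt card3).
rewrite (@interval_card (fun i => L 3 <= nu i)%N 0 3) //; first by lia.
move=> i; rewrite /nu /nat_moved /= -/(L i).
have L4' := L4 4 isT.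
have [->|i3] := eqVneq (i : nat) 3; first by lia.
have [->|i4] := eqVneq (i : nat) 4; first by lia.
by have := level3 i; lia.
Qed.

Section Low.

Hypothesis mid0 : forall x, 3 <= x -> x <= r - 4 -> a x = 0.

(** The background: the value of the partition on the middle positions. *)
Let s := L 3.

Lemma low_background x : 3 <= x -> x <= r - 3 -> L x = s.
Proof.
by move=> x3 xr; apply: weight_part_const => // z zx; apply: mid0; lia.
Qed.

Lemma low_values :
  [/\ L 0 = s + (a 0 + a 1 + a 2), L 1 = s + (a 1 + a 2), L 2 = s + a 2 &
   L 3 = s /\ L 4 = s] /\
  [/\ L (r - 2) = a (r - 2) + a (r - 1), L (r - 1) = a (r - 1), L r = 0 &
   s = a (r - 3) + a (r - 2) + a (r - 1)].
Proof.
have L0 := L_decr 0; have L1 := L_decr 1; have L2 := L_decr 2.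
have Lr1 := L_decr (r - 1); have Lr2 := L_decr (r - 2);
  have Lr3 := L_decr (r - 3).
rewrite (_ : (r - 1).+1 = r) in Lr1; last by lia.
rewrite (_ : (r - 2).+1 = r - 1) in Lr2; last by lia.
rewrite (_ : (r - 3).+1 = r - 2) in Lr3; last by lia.
have Lr : L r = 0 by exact: weight_part_end.
have L4 : L 4 = s by apply: low_background; lia.
have s3 : L (r - 3) = s by apply: low_background; lia.
by do 2!split=> //; move: L0 L1 L2 Lr1 Lr2 Lr3; rewrite -/s; lia.
Qed.

(** There are at most three entries above the background and at most three below
    it, and then four of them are enough for the two-level count. *)
Lemma low_three_sides :
  4 <= (0 < a 0 + a 1 + a 2) + (0 < a 1 + a 2) + (0 < a 2)
    + ((0 < a (r - 3)) + (0 < a (r - 2) + a (r - 3)) + (0 < s)) -> False.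
Proof.
have [[L0 L1 L2 [L3 L4]] [Lr2 Lr1 Lr s_eq]] := low_values.
set A := _ + _ + (0 < a 2); set B := _ + (0 < s) => AB.
have A3 : A <= 3 by rewrite /A; do 3!case: (0 < _).
have B3 : B <= 3 by rewrite /B; do 3!case: (0 < _).
have P12 x : s < x -> ~~ (x < s) by move=> sx; rewrite -leqNgt ltnW.
apply: (two_levels_false (P1 := fun x => s < x) (P2 := fun x => x < s)
  (i := A) (j := B) P12 L_wt).
- rewrite (card_ends (p := fun i => s < L i)) //; last first.
    by move=> z zm; rewrite low_background ?ltnn //; lia.
  rewrite L0 L1 L2 L3 L4 Lr2 Lr1 Lr ltnn.
  have lt_add x : (s < s + x) = (0 < x) by rewrite -[X in X < _]addn0 ltn_add2l.
  have f2 : (s < a (r - 2) + a (r - 1)) = false by lia.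
  have f1 : (s < a (r - 1)) = false by lia.
  by rewrite !lt_add f1 f2 !addn0.
- rewrite (card_ends (p := fun i => L i < s)) //; last first.
    by move=> z zm; rewrite low_background ?ltnn //; lia.
  have add_lt x : (s + x < s) = false by rewrite ltnNge leq_addr.
  rewrite L0 L1 L2 L3 L4 Lr2 Lr1 Lr ltnn !add_lt !add0n /B.
  congr (_ + _ + _); congr nat_of_bool; rewrite s_eq; lia.
by apply: binom4_lt_two_levels => //; move: A3 B3 AB; lia.
Qed.

(** The booleans say which positions leave the background. *)
Definition off_background (nu : nat -> nat) (b : seq bool) : Prop :=
  (forall z, 5 <= z -> z < r - 2 -> nu z = s) /\
  [seq nu z != s | z <- [:: 0; 1; 2; 3; 4; r - 2; r - 1; r]] = b.

Lemma off_background_card nu b : off_background nu b ->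
  #|[set i : 'I_r.+1 | nu i != s]| = count id b.
Proof.
move=> [nu_mid <-]; rewrite (card_ends (p := fun z => nu z != s)) //.
  by rewrite /= addn0 !addnA.
by move=> z /andP[z5 zr]; rewrite nu_mid ?eqxx.
Qed.

Lemma low_four_false mv b x y :
  all (fun p => p.1 < p.2 <= r) mv ->
  (forall z, count (fun p => p.1 == z) mv <= a z) ->
  off_background (nat_moved lambda mv) b -> count id b = 4 ->
  x <= r -> y <= r -> nat_moved lambda mv x != s -> nat_moved lambda mv y != s
    ->
  nat_moved lambda mv x != nat_moved lambda mv y -> False.
Proof.
move=> mv_lt mv_cnt off b4 xr yr xs ys xy.
apply: (four_nonconstant_false (c := s) (moved_wt mv_lt mv_cnt)).
- by move=> z /andP[z5 zr]; apply: off.1.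
- by have := b4; rewrite -off.2 /= addn0 !addnA.
- by exists x, y.
Qed.

Lemma low_four_three_false nu mv b b' :
  wt (fun i => nu (nat_of_ord i)) -> off_background nu b -> count id b = 4 ->
  all (fun p => p.1 < p.2 <= r) mv ->
  (forall z, count (fun p => p.1 == z) mv <= a z) ->
  off_background (nat_moved lambda mv) b' -> count id b' = 3 -> False.
Proof.
move=> nu_wt off b4 mv_lt mv_cnt off' b3.
apply: (four_three_false (P := fun x => x != s) nu_wt (moved_wt mv_lt mv_cnt)).
  by rewrite (off_background_card off).
by rewrite (off_background_card off').
Qed.

Lemma low_eq (f : dominant_weight r) (g : nat -> nat) :
  (forall i : 'I_r, f i = g i) ->
  [/\ a 0 = g 0, a 1 = g 1 & a 2 = g 2] ->
  [/\ a (r - 3) = g (r - 3), a (r - 2) = g (r - 2) & a (r - 1) = g (r - 1)] ->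
  (forall x, 3 <= x -> x < r - 3 -> g x = 0) -> lambda = f.
Proof.
move=> fg [g0 g1 g2] [g3 g4 g5] g_mid; apply/ffunP => i.
rewrite fg -coeffE -/(a i); move: (nat_of_ord i) (ltn_ord i) => x xr.
have [e|[e|[e|[e|[e|[e|[e1 e2]]]]]]] : x = 0 \/ x = 1 \/ x = 2 \/ x = r - 3 \/
  x = r - 2 \/ x = r - 1 \/ 3 <= x /\ x < r - 3 by lia.
all: try by rewrite e.
by rewrite g_mid // mid0 //; lia.
Qed.

(* Each position leaves the background or not by a linear inequality. *)
Ltac background_tac :=
  have [[? ? ? [? ?]] [? ? ? ?]] := low_values;
  split=> [? ? ?|]; rewrite /nat_moved /=; change (weight_part lambda) with L;
  [rewrite low_background; lia | congr [:: _; _; _; _; _; _; _; _]; lia].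

Ltac value_tac :=
  have [[? ? ? [? ?]] [? ? ? ?]] := low_values;
  rewrite /nat_moved /=; change (weight_part lambda) with L; lia.

Ltac source_tac :=
  let z := fresh "z" in intro z; rewrite /=;
  have [->|?] := eqVneq z 0; [lia|]; have [->|?] := eqVneq z 1; [lia|];
  have [->|?] := eqVneq z 2; [lia|]; have [->|?] := eqVneq z (r - 1); lia.

(* The arguments are the moves, the positions that leave the background after
   them, and two positions with different values off the background. *)
Ltac four_tac mv b x y :=
  exfalso; apply: (@low_four_false mv b x y);
  [by rewrite /=; lia | by source_tac | by background_tac | by []
  | lia | lia | by value_tac | by value_tac | by value_tac].

Ltac four_three_tac mv b mv' b' :=
  let lt := fresh in
  have lt : all (fun p => p.1 < p.2 <= r) mv; [by rewrite /=; lia|];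
  exfalso; apply: (@low_four_three_false _ mv' b b' (moved_wt lt _));
  [by source_tac | by background_tac | by [] | by rewrite /=; lia
  | by source_tac | by background_tac | by []].

Ltac listed_tac g :=
  apply: (low_eq (g := g));
  [by move=> ?; rewrite !weightE; first [done | lia] | by split;
    lia | by split; lia | by lia].

Let b123 := [:: true; true; true; false; false; false; false; false].
Let b1234 := [:: true; true; true; true; false; false; false; false].

Lemma one_side_first : 0 < a 0 -> a 1 = 0 -> a 2 = 0 -> a (r - 3) = 0 ->
  a (r - 2) = 0 -> a (r - 1) = 0 -> listed lambda.
Proof.
move=> a0 a1 a2 b3 b2 b1.
have [small|] := leqP (a 0) 3.
  right; left; exists (a 0); split; first by rewrite a0.
  left; have e k : a 0 = k -> lambda = (fundamental_weight r 1%N *+ k)%R.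
    by move=> ak; listed_tac (fun x => (x.+1 == 1) * k).
  exact: e.
rewrite leq_eqVlt => /orP[/eqP a4|a5].
  four_three_tac [:: (0, 1); (0, 2); (0, 3)] b1234 [:: (0, 1); (0, 2)] b123.
by four_tac [:: (0, 1); (0, 2); (0, 3)] b1234 0 1.
Qed.

(** The two orbits are those of (1,1,1,1) and (2,1,1). *)
Lemma double_second_false : a 0 = 0 -> a 1 = 2 -> a 2 = 0 -> a (r - 3) = 0 ->
  a (r - 2) = 0 -> a (r - 1) = 0 -> False.
Proof.
move=> a0 a1 a2 b3 b2 b1.
have lambdaE (j : 'I_r) : lambda j = if j == 1 :> nat then 2 else 0.
  have -> : lambda = (fundamental_weight r 2%N *+ 2%N)%R.
    by listed_tac (fun x => (x.+1 == 2) * 2).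
  by rewrite !weightE; case: (nat_of_ord j) => [|[|?]].
have r1 : 1 < r by lia.
have two_n0 : (2%:R != 0 :> F)%R.
  by apply: (lambda_unit (j := Ordinal r1)); rewrite lambdaE.
have nu_wt : wt (fun i => nat_of_bool (nat_of_ord i < 4)).
  by apply: double_second_weight => //; lia.
apply: (@low_four_three_false (fun x => nat_of_bool (x < 4)) [:: (1, 2)] b1234
  b123 nu_wt).
- have [[? ? ? [? ?]] [? ? ? ?]] := low_values.
  split=> [z z5 zr|]; first by lia.
  by rewrite /=; congr [:: _; _; _; _; _; _; _; _]; lia.
- by [].
- by rewrite /=; lia.
- by source_tac.
- by background_tac.
- by [].
Qed.

Lemma one_side_second : 0 < a 1 -> a 2 = 0 -> a (r - 3) = 0 ->
  a (r - 2) = 0 -> a (r - 1) = 0 -> listed lambda.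
Proof.
move=> a1 a2 b3 b2 b1.
have [a0|a0] := posnP (a 0).
  have [a11|[a12|a13]] : a 1 = 1 \/ a 1 = 2 \/ 3 <= a 1 by lia.
  - by do 3 right; left; left; listed_tac (fun x => nat_of_bool (x.+1 == 2)).
  - by case: double_second_false.
  - by four_tac [:: (1, 2); (1, 3)] b1234 0 2.
have [a12|a11] : 2 <= a 1 \/ a 1 = 1 by lia.
  by four_tac [:: (0, 2); (1, 3)] b1234 0 2.
have [a01|[a02|a03]] : a 0 = 1 \/ a 0 = 2 \/ 3 <= a 0 by lia.
- by do 6 right; left; left; listed_tac (fun x => (x.+1 == 1) + (x.+1 == 2)).
- by four_three_tac [:: (0, 2); (0, 3)] b1234 [:: (0, 2)] b123.
- by four_tac [:: (0, 2); (0, 3)] b1234 0 1.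
Qed.

Lemma one_side_third : 0 < a 2 -> a (r - 3) = 0 ->
  a (r - 2) = 0 -> a (r - 1) = 0 -> listed lambda.
Proof.
move=> a2 b3 b2 b1.
have [a22|a21] : 2 <= a 2 \/ a 2 = 1 by lia.
  by four_tac [:: (2, 3)] b1234 0 3.
have [a1|a1] := posnP (a 1); last by four_tac [:: (1, 3)] b1234 0 3.
have [a00|[a01|a02]] : a 0 = 0 \/ a 0 = 1 \/ 2 <= a 0 by lia.
- by do 4 right; left; left; listed_tac (fun x => nat_of_bool (x.+1 == 3)).
- by four_three_tac [:: (0, 3)] b1234 (Nil (nat * nat)) b123.
- by four_tac [:: (0, 3)] b1234 0 1.
Qed.

(** In the last alternative the first position has only one unit to give, while
    in the dual weight it has at least three. *)
Lemma two_sides_first : 0 < a 0 -> a 1 = 0 -> a 2 = 0 -> a (r - 3) = 0 ->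
  a (r - 2) = 0 -> 0 < a (r - 1) -> listed lambda \/ a 0 = 1 /\ 3 <= a (r - 1).
Proof.
move=> a0 a1 a2 b3 b2 b1.
have [[a01 b13]|[[a01 b11]|[[a01 b12]|[[a02 b11]|[[a03 b11]|[a02 b12]]]]]] :
    a 0 = 1 /\ 3 <= a (r - 1) \/ a 0 = 1 /\ a (r - 1) = 1 \/
    a 0 = 1 /\ a (r - 1) = 2 \/ a 0 = 2 /\ a (r - 1) = 1 \/
    3 <= a 0 /\ a (r - 1) = 1 \/ 2 <= a 0 /\ 2 <= a (r - 1) by lia.
- by right.
- by left; do 2 right; left; listed_tac (fun x => (x.+1 == 1) + (x.+1 == r)).
- left; do 7 right; left; right.
  by listed_tac (fun x => (x.+1 == 1) + (x.+1 == r) * 2).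
- left; do 7 right; left; left.
  by listed_tac (fun x => (x.+1 == 1) * 2 + (x.+1 == r)).
- four_tac [:: (0, 1); (0, 2)]
    [:: true; true; true; false; false; false; false; true] 0 r.
- four_tac [:: (0, 1); (r - 1, r)]
    [:: true; true; false; false; false; false; true; true] 0 r.
Qed.

Lemma two_sides_second : 0 < a 1 -> a 2 = 0 -> a (r - 3) = 0 ->
  a (r - 2) = 0 -> 0 < a (r - 1) -> listed lambda.
Proof.
move=> a1 a2 b3 b2 b1.
have [a0|a0] := posnP (a 0); last first.
  by four_tac [:: (0, 2)] [:: true; true; true; false; false; false; false;
    true] 2 r.
have [a12|a11] : 2 <= a 1 \/ a 1 = 1 by lia.
  by four_tac [:: (1, 2)] [:: true; true; true; false; false; false; false;
    true] 2 r.
have [b12|b11] : 2 <= a (r - 1) \/ a (r - 1) = 1 by lia.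
  by four_tac [:: (r - 1, r)] [:: true; true; false; false; false; false;
    true; true] 0 r.
by do 8 right; left; listed_tac (fun x => (x.+1 == 2) + (x.+1 == r)).
Qed.

(** The two-level count leaves at most three entries off the background, and by
    hypothesis there are no fewer above it than below. *)
Lemma low_cases :
  (0 < a (r - 3) -> 0 < a 2) -> (0 < a (r - 2) -> 0 < a 1 + a 2) ->
  (0 < a (r - 1) -> 0 < a 0 + a 1 + a 2) ->
  listed lambda \/
  [/\ a 0 = 1, 3 <= a (r - 1) & forall x, 0 < x -> x < r - 1 -> a x = 0].
Proof.
move=> hQ3 hQ2 hQ1.
have [[? ? ? [? ?]] [? ? ? s_eq]] := low_values.
have [a2|a2] := posnP (a 2); last first.
  left; have s0 : s = 0.
    apply/eqP; rewrite -leqn0 leqNgt; apply/negP => s0; apply: low_three_sides.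
    by rewrite a2 s0 !addn_gt0 a2 !orbT; lia.
  by apply: one_side_third => //; lia.
have b3 : a (r - 3) = 0 by move: hQ3; rewrite a2;
  case: (a (r - 3)) => // n /(_ isT).
have [a1|a1] := posnP (a 1); last first.
  have b2 : a (r - 2) = 0.
    apply/eqP; rewrite -leqn0 leqNgt; apply/negP => b2; apply: low_three_sides.
    by rewrite a2 b3 !addn_gt0 a1 b2 s_eq b3 !addn_gt0 b2 !orbT.
  have [b1|b1] := posnP (a (r - 1)); left.
    exact: one_side_second.
  exact: two_sides_second.
have b2 : a (r - 2) = 0.
  by move: hQ2; rewrite a1 a2; case: (a (r - 2)) => // n /(_ isT).
have [a0|a0] := posnP (a 0).
  have b1 : a (r - 1) = 0.
    by move: hQ1; rewrite a0 a1 a2; case: (a (r - 1)) => // n /(_ isT).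
  left; left; apply: (low_eq (g := fun=> 0)) => //.
  by move=> i; rewrite ffunE.
have [b1|b1] := posnP (a (r - 1)); first by left; apply: one_side_first.
have [|[a01 b13]] := two_sides_first a0 a1 a2 b3 b2 b1; first by left.
right; split=> // x x0 xr.
have [->|[->|[->|[->|[x3 xr']]]]] : x = 1 \/ x = 2 \/ x = r - 3 \/ x = r - 2 \/
    3 <= x /\ x <= r - 4 by lia.
all: try by [].
exact: mid0.
Qed.

End Low.

End Cases.

(** * Duality *)

(** The automorphism of SL that exchanges the roles of the two ends of the
    Dynkin diagram: inverse transpose followed by reversal of the basis. *)
Definition flip (F : fieldType) n (A : 'M[F]_n) : 'M[F]_n :=
  \matrix_(i, j) (\adj A) (rev_ord j) (rev_ord i).

Lemma adj_unique (F : fieldType) n (A B : 'M[F]_n) :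
  A \in SL n F -> A *m B = 1%:M -> \adj A = B.
Proof.
rewrite inE => /eqP dA AB.
transitivity (\adj A *m (A *m B)); first by rewrite AB mulmx1.
by rewrite mulmxA mul_adj_mx dA mul1mx.
Qed.

Lemma SL_adjr (F : fieldType) n (A : 'M[F]_n) :
  A \in SL n F -> A *m \adj A = 1%:M.
Proof. by rewrite inE mul_mx_adj => /eqP->. Qed.

Lemma flipM (F : fieldType) n : {in SL n F &, {morph @flip F n : A B / A *m B}}.
Proof.
move=> A B A1 B1.
have -> : flip A *m flip B =
    \matrix_(i, j) (\adj B *m \adj A) (rev_ord j) (rev_ord i).
  apply/matrixP => i j; rewrite !mxE (reindex_inj rev_ord_inj) /=.
  by apply: eq_bigr => k _; rewrite !mxE rev_ordK mulrC.
rewrite /flip (adj_unique (B := \adj B *m \adj A)) ?SL_mul //.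
by rewrite mulmxA -[A *m B *m _]mulmxA SL_adjr // mulmx1 SL_adjr.
Qed.

Lemma det_rev (F : fieldType) n (A : 'M[F]_n) :
  \det (\matrix_(i, j) A (rev_ord i) (rev_ord j)) = \det A.
Proof.
pose s : 'S_n := perm (@rev_ord_inj n).
have -> : \matrix_(i, j) A (rev_ord i) (rev_ord j) = row_perm s (col_perm s A).
  by apply/matrixP => i j; rewrite !mxE !permE.
rewrite row_permE col_permE !det_mulmx !det_perm odd_permV mulrCA -signr_addb.
by rewrite addbb mulr1.
Qed.

Lemma flip_SL (F : fieldType) n (A : 'M[F]_n) :
  A \in SL n F -> flip A \in SL n F.
Proof.
move=> A1; rewrite inE -det_tr.
have -> : (flip A)^T = \matrix_(i, j) \adj A (rev_ord i) (rev_ord j).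
  by apply/matrixP => i j; rewrite !mxE.
rewrite det_rev; have := congr1 determinant (SL_adjr A1).
by move: A1; rewrite inE det_mulmx det1 => /eqP->; rewrite mul1r => ->.
Qed.

Lemma flipK (F : fieldType) n (A : 'M[F]_n) :
  A \in SL n F -> flip (flip A) = A.
Proof.
move=> A1; pose X : 'M[F]_n := \matrix_(i, j) A (rev_ord j) (rev_ord i).
have XE : \adj (flip A) = X.
  apply: adj_unique (flip_SL A1) _.
  apply/matrixP => i j; rewrite !mxE (reindex_inj rev_ord_inj) /=.
  have := SL_adjr A1 => /matrixP/(_ (rev_ord j) (rev_ord i)); rewrite !mxE.
  rewrite (inj_eq rev_ord_inj) eq_sym => <-.
  by apply: eq_bigr => k _; rewrite !mxE !rev_ordK mulrC.
by apply/matrixP => i j; rewrite mxE XE mxE !rev_ordK.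
Qed.

(** Back substitution in u B = 1, from the last row upwards. *)
Lemma adj_unitriangular (F : fieldType) n (u : 'M[F]_n) :
  upper_unitriangular u -> upper_unitriangular (\adj u).
Proof.
move=> hu; have u1 : u \in SL n F by rewrite inE det_upper_unitriangular.
move: (\adj u) (SL_adjr u1) => B uB i j ji.
move: {2}(n - i)%N (leqnn (n - i)) => k; elim: k i j ji => [|k IH] i j ji ik.
  by have := ltn_ord i; lia.
have := uB => /matrixP/(_ i j); rewrite !mxE (bigD1 i) //= hu // eqxx.
rewrite mul1r big1 ?addr0 // => l li.
have [lti|ilt] := leqP l i; first by rewrite hu // eq_sym (negPf li) mul0r.
rewrite IH; [|lia|by have := ltn_ord l; lia].
by rewrite -val_eqE /= gtn_eqF ?mulr0 //; lia.
Qed.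

Lemma flip_unitriangular (F : fieldType) n (u : 'M[F]_n) :
  upper_unitriangular u -> upper_unitriangular (flip u).
Proof.
move=> hu i j ji; rewrite mxE adj_unitriangular //=; last by lia.
by rewrite (inj_eq rev_ord_inj) eq_sym.
Qed.

Lemma flip_diag (F : fieldType) n (t : 'rV[F]_n) :
  diag_mx t \in SL n F -> flip (diag_mx t) = diag_mx (\row_i (t 0 (rev_ord
    i))^-1).
Proof.
move=> t1; have t_n0 i : t 0 i != 0.
  move: t1; rewrite inE det_diag => /eqP t1; apply: contraTneq (oner_neq0 F) =>
    ti.
  by rewrite -t1 (bigD1 i) //= ti mul0r eqxx.
rewrite /flip (adj_unique (B := diag_mx (\row_i (t 0 i)^-1))) //.
  apply/matrixP => i j; rewrite !mxE (inj_eq rev_ord_inj) eq_sym.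
  by case: eqP => [->|].
rewrite mulmx_diag; apply/matrixP => i j; rewrite !mxE.
by case: eqP => // ->; rewrite mulfV.
Qed.

Definition dual_weight r (lambda : dominant_weight r) : dominant_weight r :=
  [ffun j => lambda (rev_ord j)].

Lemma coeff_dual r (lambda : dominant_weight r) x : (x < r)%N ->
  coeff (dual_weight lambda) x = coeff lambda (r - x.+1).
Proof.
move=> xr; rewrite -[x in LHS]/(nat_of_ord (Ordinal xr)) coeffE ffunE -coeffE.
by [].
Qed.

(** On SL the inverse of a product of diagonal entries is the product of the
    other ones. *)
Lemma weight_character_flip (F : fieldType) r (lambda : dominant_weight r)
    (t : 'rV[F]_r.+1) : diag_mx t \in SL r.+1 F ->
  weight_character lambda (\row_i (t 0 (rev_ord i))^-1) =
  weight_character (dual_weight lambda) t.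
Proof.
rewrite inE det_diag => /eqP t1.
rewrite /weight_character [RHS](reindex_inj rev_ord_inj) /=.
apply: eq_bigr => j _; rewrite ffunE rev_ordK; congr (_ ^+ _).
rewrite (reindex_inj rev_ord_inj) /=.
under eq_bigr do rewrite mxE rev_ordK.
rewrite prodfV; set X := \prod_(i | _) _; set Y := RHS.
have XY : X * Y = 1.
  rewrite -[RHS]t1 [RHS](bigID (fun i => rev_ord i <= j)%N) /=; congr (_ * _).
  by apply: eq_bigl => i /=; have := ltn_ord i; have := ltn_ord j; lia.
have X0 : X != 0.
  by apply: contraTneq (oner_neq0 F) => X0; rewrite -XY X0 mul0r eqxx.
by rewrite -[RHS](mulKf X0) XY mulr1.
Qed.

Lemma regular_comp n (F : fieldType) (T : 'M[F]_n -> 'M[F]_n) (f : 'M[F]_n ->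
  F) :
  (forall i j, regular_on_SL (fun A => T A i j)) ->
  (forall A, A \in SL n F -> T A \in SL n F) ->
  regular_on_SL f -> regular_on_SL (f \o T).
Proof.
move=> T_reg T_SL [P fP].
have [Q QE] : regular_on_SL (fun A => P.@[fun k => mxvec (T A) 0 k]).
  apply: (@regular_eq _ _ (fun A => \sum_(m <- msupp P) P@_m *
      \prod_k \prod_(b < m k) mxvec (T A) 0 k)) => [A|].
    rewrite mevalE; apply: eq_bigr => m _; congr (_ * _).
    by apply: eq_bigr => k _; rewrite prodr_const card_ord.
  apply: regular_sum => m; apply: regular_mul (regular_const _ _) _.
  apply: regular_prod => k; apply: regular_prod => b.
  case/mxvec_indexP: k b => i j _; apply: regular_eq (T_reg i j) => A.
  by rewrite mxvecE.
by exists Q => A A1; rewrite /= fP ?T_SL // QE.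
Qed.

Lemma regular_flip n (F : fieldType) i j :
  regular_on_SL (fun A : 'M[F]_n => flip A i j).
Proof.
apply: (@regular_eq _ _ (fun A : 'M[F]_n => (-1) ^+ (rev_ord i + rev_ord j) *
  \sum_(s : 'S_n.-1) (-1) ^+ s *
    \prod_k A (lift (rev_ord i) k) (lift (rev_ord j) (s k)))) => [A|].
  rewrite !mxE /cofactor; congr (_ * _); apply: eq_bigr => s _; congr (_ * _).
  by apply: eq_bigr => k _; rewrite !mxE.
apply: regular_mul (regular_const _ _) _; apply: regular_sum => s.
apply: regular_mul (regular_const _ _) _; apply: regular_prod => k.
exact: regular_entry.
Qed.

Lemma flip_rational (F : fieldType) n (V : vectType F) (rho : 'M[F]_n ->
  'End(V)) :
  is_rational_repr rho -> is_rational_repr (rho \o @flip F n).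
Proof.
move=> [[rho1 rhoM] rho_reg]; split=> [|phi v].
  split; last by move=> A B A1 B1; rewrite /= flipM // rhoM ?flip_SL.
  rewrite /= -[RHS]rho1; congr rho; rewrite /flip (adj_unique (B := 1%:M)) ?SL1
    ?mulmx1 //.
  by apply/matrixP => i j; rewrite !mxE (inj_eq rev_ord_inj) eq_sym.
by apply: (regular_comp (@regular_flip _ _) (@flip_SL _ _) (rho_reg phi v)).
Qed.

Lemma flip_irreducible (F : fieldType) n (V : vectType F)
    (rho : 'M[F]_n -> 'End(V)) :
  is_irreducible rho -> is_irreducible (rho \o @flip F n).
Proof.
move=> [V0 irr]; split=> // U stab; apply: irr => A A1.
by have := stab (flip A) (flip_SL A1); rewrite /= flipK.
Qed.

Lemma flip_highest_weight (F : fieldType) r (V : vectType F)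
    (rho : 'M[F]_r.+1 -> 'End(V)) (lambda : dominant_weight r) :
  has_highest_weight rho lambda ->
  has_highest_weight (rho \o @flip F r.+1) (dual_weight lambda).
Proof.
move=> [v [v0 v_up v_tor]]; exists v; split=> //=.
  by move=> u hu; rewrite v_up //; apply: flip_unitriangular.
move=> t t1; rewrite -weight_character_flip // -v_tor ?flip_diag //.
by rewrite -flip_diag // flip_SL.
Qed.

Lemma listed_dual r (lambda : dominant_weight r) : (7 <= r)%N ->
  listed (dual_weight lambda) -> listed lambda.
Proof.
move=> r7.
have dualE (f g : dominant_weight r) : (forall i : 'I_r, f (rev_ord i) = g i) ->
    dual_weight lambda = f -> lambda = g.
  by move=> fg e; apply/ffunP => i; rewrite -fg -e ffunE rev_ordK.
case=> [e|[[k [k3 e]]|[e|[e|[e|[e|[e|[e|e]]]]]]]].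
- by left; apply: dualE e => i; rewrite !ffunE.
- right; left; exists k; split=> //; case: e => e; [right|left];
  apply: dualE e => i; rewrite !weightE /=; congr (nat_of_bool _ * _)%N;
  have := ltn_ord i; lia.
- by do 2 right; left; apply: dualE e => i; rewrite !weightE /=;
    have := ltn_ord i; lia.
- do 3 right; left; case: e => e; [right|left];
  by apply: dualE e => i; rewrite !weightE /=; have := ltn_ord i; lia.
- do 4 right; left; case: e => e; [right|left];
  by apply: dualE e => i; rewrite !weightE /=; have := ltn_ord i; lia.
- do 5 right; left; case: e => e; [right|left];
  by apply: dualE e => i; rewrite !weightE /=; have := ltn_ord i; lia.
- do 6 right; left; case: e => e; [right|left];
  by apply: dualE e => i; rewrite !weightE /=; have := ltn_ord i; lia.
- do 7 right; left; case: e => e; [right|left];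
  by apply: dualE e => i; rewrite !weightE /=; have := ltn_ord i; lia.
- do 8 right; case: e => e; [right|left];
  by apply: dualE e => i; rewrite !weightE /=; have := ltn_ord i; lia.
Qed.

Lemma natr_unit_restricted (F : fieldType) p r (lambda : dominant_weight r) :
  has_characteristic F p -> ((0 < p)%N -> restricted p lambda) ->
  forall j b, (0 < b <= lambda j)%N -> b%:R != 0 :> F.
Proof.
rewrite /has_characteristic; case: eqP => [_ char0 _|p0 charp res] j b /andP[b0
  bj].
  by rewrite (pcharf0P F).1 // -lt0n.
rewrite -(dvdn_pcharf charp) gtnNdvd //; apply: leq_ltn_trans bj _.
by apply: res; rewrite lt0n; apply/eqP.
Qed.

Theorem theorem7p3 (F : closedFieldType) (p : nat)
    (hp : has_characteristic F p) (r : nat) (hr : (8 <= r.+1)%N)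
    (V : vectType F) (rho : 'M[F]_r.+1 -> 'End(V))
    (rho_rational : is_rational_repr rho) (rho_irr : is_irreducible rho)
    (lambda : dominant_weight r) (rho_lambda : has_highest_weight rho lambda)
    (lambda_restricted : (0 < p)%N -> restricted p lambda)
    (hdim : (\dim {:V} <= dim_bound r.+1)%N) :
  let w := fundamental_weight r in
  lambda = 0
  \/ (exists a : nat, (1 <= a <= 3)%N /\
        (lambda = w 1%N *+ a \/ lambda = w r *+ a))
  \/ lambda = w 1%N + w r
  \/ (lambda = w 2%N \/ lambda = w (r - 1)%N)
  \/ (lambda = w 3%N \/ lambda = w (r - 2)%N)
  \/ (lambda = w 4%N \/ lambda = w (r - 3)%N)
  \/ (lambda = w 1%N + w 2%N \/ lambda = w (r - 1)%N + w r)
  \/ (lambda = w 1%N *+ 2 + w r \/ lambda = w 1%N + w r *+ 2)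
  \/ (lambda = w 2%N + w r \/ lambda = w 1%N + w (r - 1)%N).
Proof.
have r7 : (7 <= r)%N := hr.
pose mu := dual_weight lambda.
have mu_restricted : (0 < p)%N -> restricted p mu.
  by move=> p0 i; rewrite ffunE; apply: lambda_restricted.
have unitl := natr_unit_restricted hp lambda_restricted.
have unitm := natr_unit_restricted hp mu_restricted.
have countl nus := @irreducible_weights_leq_dim _ _ _ _ _ nus rho_rational
  rho_irr rho_lambda.
have countm nus := @irreducible_weights_leq_dim _ _ _ _ _ nus
  (flip_rational rho_rational) (flip_irreducible rho_irr)
  (flip_highest_weight rho_lambda).
rewrite -/(listed lambda).
have muE x : (x < r)%N -> coeff mu x = coeff lambda (r - x.+1) by exact:
  coeff_dual.
have [a3|a3] := posnP (coeff lambda 3); last exact: fourth_coeff unitl hdim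
  countl a3.
have [b4|b4] := posnP (coeff mu 3); last first.
  exact: listed_dual r7 (fourth_coeff r7 unitm hdim countm b4).
have b4' : coeff lambda (r - 4) = 0%N by rewrite -muE //; lia.
have mid0 x : (3 <= x)%N -> (x <= r - 4)%N -> coeff lambda x = 0%N.
  move=> x3 xr; have [->//|x3'] := eqVneq x 3%N.
  have [->//|xr'] := eqVneq x (r - 4)%N.
  apply/eqP; rewrite -leqn0 leqNgt; apply/negP => ax.
  by apply: (middle_coeff_false r7 unitl hdim countl _ _ ax); lia.
have mid0' x : (3 <= x)%N -> (x <= r - 4)%N -> coeff mu x = 0%N.
  by move=> x3 xr; rewrite muE ?mid0 //; lia.
have lowl := low_cases r7 unitl hdim countl mid0.
have lowm := low_cases r7 unitm hdim countm mid0'.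
have mu0 : coeff mu 0 = coeff lambda (r - 1) by rewrite muE //; lia.
have mu1 : coeff mu 1 = coeff lambda (r - 2) by rewrite muE //; lia.
have mu2 : coeff mu 2 = coeff lambda (r - 3) by rewrite muE //; lia.
have mur1 : coeff mu (r - 1) = coeff lambda 0.
  by rewrite muE; [congr coeff; lia | lia].
have mur2 : coeff mu (r - 2) = coeff lambda 1.
  by rewrite muE; [congr coeff; lia | lia].
have mur3 : coeff mu (r - 3) = coeff lambda 2.
  by rewrite muE; [congr coeff; lia | lia].
rewrite mu0 mu1 mu2 mur1 mur2 mur3 in lowm.
(* An exceptional weight has a dual to which the case analysis applies as well,
   and the dual is not exceptional. *)
have exception_l : [/\ coeff lambda 0 = 1%N, (3 <= coeff lambda (r - 1))%N &
    forall x, (0 < x)%N -> (x < r - 1)%N -> coeff lambda x = 0%N] -> listed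
      lambda.
  move=> [a0 b1 rest].
  have a1 : coeff lambda 1 = 0%N by apply: rest; lia.
  have a2 : coeff lambda 2 = 0%N by apply: rest; lia.
  case: lowm => [|||/(listed_dual r7) //|[b11 _ _]]; rewrite ?a0 ?a1 ?a2 //;
    first by lia.
  by move: b1; rewrite b11.
have exception_m : [/\ coeff lambda (r - 1) = 1%N, (3 <= coeff lambda 0)%N &
    forall x, (0 < x)%N -> (x < r - 1)%N -> coeff mu x = 0%N] -> listed lambda.
  move=> [b1 a0 rest].
  have b2 : coeff lambda (r - 2) = 0%N by rewrite -mu1; apply: rest; lia.
  have b3 : coeff lambda (r - 3) = 0%N by rewrite -mu2; apply: rest; lia.
  case: lowl => [||| //|[a01 _ _]]; rewrite ?b1 ?b2 ?b3 //; first by lia.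
  by move: a0; rewrite a01.
have from_l : listed lambda \/ [/\ coeff lambda 0 = 1%N,
    (3 <= coeff lambda (r - 1))%N &
    forall x, (0 < x)%N -> (x < r - 1)%N -> coeff lambda x = 0%N] -> listed
      lambda.
  by case.
have from_m : listed mu \/ [/\ coeff lambda (r - 1) = 1%N,
    (3 <= coeff lambda 0)%N &
    forall x, (0 < x)%N -> (x < r - 1)%N -> coeff mu x = 0%N] -> listed lambda.
  by case=> [/(listed_dual r7)|].
(* The side whose nonzero coefficients reach farther from its end has more
   entries off the background, and decides between lambda and its dual. *)
have [a2|a2] := posnP (coeff lambda 2); last by apply/from_l/lowl; lia.
have [b3|b3] := posnP (coeff lambda (r - 3)); last by apply/from_m/lowm; lia.
have [a1|a1] := posnP (coeff lambda 1); last by apply/from_l/lowl; lia.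
have [b2|b2] := posnP (coeff lambda (r - 2)); last by apply/from_m/lowm; lia.
have [a0|a0] := posnP (coeff lambda 0); last by apply/from_l/lowl; lia.
by apply/from_m/lowm; lia.
Qed.
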